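(* Let $T$ be a paraproduct-free bi-parameter Journé singular integral on $\mathbb{R}^2=\mathbb{R}\times\mathbb{R}$. Then there exist $\delta>0$, a constant $C$ (depending on $T$) and an absolute $\eta\in(0,1)$ such that the following holds. Let $f,g$ be test functions on $\mathbb{R}^2$ with finitely many nonzero bi-parameter Haar coefficients. For each pair $i=(i_1,i_2)$, $j=(j_1,j_2)$ of tuples of non-negative integers set $\tau_{i,j}=2^{-(i_1+i_2+j_1+j_2)}$, and let $S^{i,j}_\omega$ be the shifted square function defined with respect to the random dyadic system $\mathcal{D}_\omega=\mathcal{D}_{\omega_1}\times\mathcal{D}_{\omega_2}$. Then there are collections of rectangles $\Lambda_{i,j}=\Lambda_{i,j}(\omega)$ (depending on $f,g$), each sparse with parameter $\eta$, such that $$|\langle Tf,g\rangle|\le C\;\mathbb{E}_{\omega_1}\mathbb{E}_{\omega_2}\sum_{i,j\ge0}2^{-\max(i_1,j_1)\delta/2}\,2^{-\max(i_2,j_2)\delta/2}\,\tau_{i,j}\sum_{R\in\Lambda_{i,j}}|R|\,(S^{i,j}_\omega f)_R\,(S^{j,i}_\omega g)_R .$$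
   Context: Random grids. Let $\mathcal{D}_0$ be the standard dyadic intervals in $\mathbb{R}$. For $\eta=(\eta_k)_{k\in\mathbb{Z}}\in\{0,1\}^{\mathbb{Z}}$ put $\mathcal{D}_\eta=\{I+\eta: I\in\mathcal{D}_0\}$, $I+\eta:=I+\sum_{2^{-k}<|I|}2^{-k}\eta_k$. The space $\{0,1\}^{\mathbb{Z}}$ carries the Bernoulli$(1/2)$ product measure; $\omega=(\omega_1,\omega_2)$ with $\omega_1,\omega_2\in\{0,1\}^{\mathbb{Z}}$ independent, and $\mathbb{E}_{\omega_1},\mathbb{E}_{\omega_2}$ are the corresponding expectations. $\mathcal{D}_\omega=\mathcal{D}_{\omega_1}\times\mathcal{D}_{\omega_2}$ is the set of rectangles $R=R_1\times R_2$, $R_k\in\mathcal{D}_{\omega_k}$. Haar functions. $h_I=|I|^{-1/2}(1_{I_l}-1_{I_r})$ ($I_l,I_r$ the left and right halves of $I$), $h_R=h_{R_1}\otimes h_{R_2}$, $\hat f(R)=\langle f,h_R\rangle$. $(I)_k$ is the set of dyadic $J\subset I$ of the same grid with $|J|=2^{-k}|I|$. Shifted square function with respect to a dyadic system $\mathcal{D}_1\times\mathcal{D}_2$: $$(S^{i,j}f(y))^2=\sum_{\substack{R_1\in\mathcal{D}_1\\R_2\in\mathcal{D}_2}}\Big(\sum_{\substack{P_1\in(R_1)_{i_1}\\P_2\in(R_2)_{i_2}}}|\hat f(P_1\times P_2)|\Big)^2\Big(\sum_{\substack{Q_1\in(R_1)_{j_1}\\Q_2\in(R_2)_{j_2}}}\frac{1_{Q_1}}{|Q_1|}\otimes\frac{1_{Q_2}}{|Q_2|}(y)\Big).$$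 $S_\omega^{i,j}$ is this with $\mathcal{D}_\omega$; $S_\omega^{j,i}$ exchanges $i$ and $j$. $(F)_R=\frac1{|R|}\int_RF$. A collection $\Lambda$ of rectangles is sparse (disjoint-pieces sense) with parameter $\eta>0$ if for every $R\in\Lambda$ there is $E_R\subset R$ with $|E_R|>\eta|R|$, and $E_R\cap E_{R'}=\emptyset$ whenever $R\neq R'$. Cancellative bi-parameter dyadic shift of complexity $(i,j)$ with respect to $\mathcal{D}_1\times\mathcal{D}_2$: $$T^{i,j}f=\sum_{R_1\in\mathcal{D}_1,R_2\in\mathcal{D}_2}\ \sum_{P_1\in(R_1)_{i_1},P_2\in(R_2)_{i_2}}\ \sum_{Q_1\in(R_1)_{j_1},Q_2\in(R_2)_{j_2}}a_{PQR}\hat f(P)h_Q,\qquad |a_{PQR}|\le 2^{-\frac12(i_1+j_1+i_2+j_2)},$$ where $P=P_1\times P_2$, $Q=Q_1\times Q_2$, $R=R_1\times R_2$. Bi-parameter Journé singular integral (in the sense of Martikainen) on $\mathbb{R}\times\mathbb{R}$: a linear operator $T$ for which there are $C_0<\infty$ and $\delta\in(0,1]$ with the following properties (intervals $V,W\subset\mathbb{R}$ arbitrary; a function $u_V$ is called zero-mean $V$-adapted if it is supported in $V$, $|u_V|\le1$, $\int u_V=0$). (1) Full kernel: if $f=f_1\otimes f_2$, $g=g_1\otimes g_2$ with $\mathrm{spt} f_1\cap\mathrm{spt} g_1=\emptyset$ and $\mathrm{spt} f_2\cap\mathrm{spt} g_2=\emptyset$, then $\langle Tf,g\rangle=\int\int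 K(x,y)f(y)g(x)\,dx\,dy$, where $K$ is defined for $x,y\in\mathbb{R}^2$ with $x_1\ne y_1$, $x_2\neq y_2$, and satisfies: the size condition $|K(x,y)|\le C_0|x_1-y_1|^{-1}|x_2-y_2|^{-1}$; the Hölder condition $$|K(x,y)-K(x,(y_1,y_2'))-K(x,(y_1',y_2))+K(x,y')|\le C_0\frac{|y_1-y_1'|^\delta}{|x_1-y_1|^{1+\delta}}\frac{|y_2-y_2'|^\delta}{|x_2-y_2|^{1+\delta}}$$ when $|y_1-y_1'|\le|x_1-y_1|/2$, $|y_2-y_2'|\le|x_2-y_2|/2$, together with the three analogous conditions in which the varied variables are $(x_1,x_2)$, $(x_1,y_2)$, $(y_1,x_2)$; and the mixed condition $$|K(x,y)-K(x,(y_1',y_2))|\le C_0\frac{|y_1-y_1'|^\delta}{|x_1-y_1|^{1+\delta}}\frac{1}{|x_2-y_2|}$$ when $|y_1-y_1'|\le|x_1-y_1|/2$, together with the three analogous conditions in which the single varied variable is $x_1$, $y_2$ or $x_2$. (2) Partial kernels: if only $\mathrm{spt} f_1\cap\mathrm{spt} g_1=\emptyset$, then $\langle T(f_1\otimes f_2),g_1\otimes g_2\rangle=\int\int K_{f_2,g_2}(x_1,y_1)f_1(y_1)g_1(x_1)\,dx_1dy_1$, where $K_{f_2,g_2}$ is a standard one-parameter Calderón–Zygmund kernel (size and $\delta$-Hölder conditions in $x_1$ and in $y_1$) with constant $C(f_2,g_2)$ satisfying $C(1_V,1_V)+C(1_V,u_V)+C(u_V,1_V)\le C_0|V|$ for every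 interval $V$ and every zero-mean $V$-adapted $u_V$; and symmetrically with the roles of the two variables exchanged. (3) Boundedness and cancellation: $T1$, $T^*1$, $T_1(1)$, $T_1^*(1)$ belong to product $BMO$, where $T_1$ is the partial adjoint $\langle T_1(f_1\otimes f_2),g_1\otimes g_2\rangle=\langle T(g_1\otimes f_2),f_1\otimes g_2\rangle$; $|\langle T(1_V\otimes1_W),1_V\otimes1_W\rangle|\le C_0|V||W|$; and for all zero-mean $V$-adapted $a_V$ and zero-mean $W$-adapted $b_W$, each of $|\langle T(a_V\otimes1_W),1_V\otimes1_W\rangle|$, $|\langle T(1_V\otimes1_W),a_V\otimes1_W\rangle|$, $|\langle T(1_V\otimes b_W),1_V\otimes1_W\rangle|$, $|\langle T(1_V\otimes1_W),1_V\otimes b_W\rangle|$ is at most $C_0|V||W|$. $T$ is paraproduct-free if the bi-parameter version of $T(1)=T^*(1)=0$ holds, meaning that only cancellative shifts occur in Martikainen's dyadic representation of $T$: there are $\delta>0$, a constant $C_T$, and for each $\omega,i,j$ a cancellative shift $T_\omega^{i,j}$ of complexity $(i,j)$ with respect to $\mathcal{D}_\omega$ such that for test functions $f,g$ $$\langle Tf,g\rangle=C_T\,\mathbb{E}_{\omega_1}\mathbb{E}_{\omega_2}\sum_{i,j\ge0}2^{-\max(i_1,j_1)\delta/2}2^{-\max(i_2,j_2)\delta/2}\langle T_\omega^{i,j}f,g\rangle .$$ *)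

(* Defs.v *)
From HB Require Import structures.
From mathcomp Require Import all_boot all_order all_algebra.
From mathcomp Require Import all_classical all_reals all_analysis.

Set Implicit Arguments.
Unset Strict Implicit.
Unset Printing Implicit Defensive.

Import Order.TTheory GRing.Theory Num.Theory.
Import numFieldNormedType.Exports.

Local Open Scope classical_set_scope.
Local Open Scope ring_scope.

Definition coord_sets : set (set (int -> bool)) :=
  [set [set e | e k = true] | k in [set: int]].

(** {0,1}^Z with its product sigma-algebra. *)
Definition coins := g_sigma_algebraType coord_sets.

(** By Dynkin's lemma there is only one such [P]. *)
Definition bernoulli_product (R : realType) (P : probability coins R) : Prop :=
  forall (s : seq int) (b : int -> bool), uniq s ->
    P [set e : coins | forall k, k \in s -> e k = b k] = (2^-1 ^+ size s)%:E.

(** The pair [(m, n)] codes the interval [[n 2^-m, (n+1) 2^-m[] of the standard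
    grid and, once a sequence [eta] is given, its translate in the grid of
    [eta]. *)
Definition dyad : choiceType := (int * int)%type.
Definition drect : choiceType := (dyad * dyad)%type.

Section Defs.
Variable R : realType.
Implicit Types (eta : coins) (w : coins * coins) (I J : dyad).
Implicit Types (i j : nat * nat) (P Q : drect).

Local Notation mu := (@lebesgue_measure R).
Local Notation mu2 := (@lebesgue_measure R \x @lebesgue_measure R)%E.

(** The sum of [2^-k eta_k] over all [k > m], i.e. over [2^-k < 2^-m]. *)
Definition grid_shift eta (m : int) : R :=
  limn (series (fun n : nat =>
    (2 : R) ^ (- (m + 1 + n%:Z)) * (eta (m + 1 + n%:Z))%:R)).

Definition dlen I : R := 2 ^ (- I.1).

Definition dleft eta I : R := I.2%:~R * dlen I + grid_shift eta I.1.

Definition ditv eta I : set R :=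
  `[dleft eta I, dleft eta I + dlen I[%classic.

Definition descendants eta I (k : nat) : set dyad :=
  [set J | J.1 = I.1 + k%:Z /\ ditv eta J `<=` ditv eta I].

Definition haar eta I (x : R) : R :=
  let a := dleft eta I in
  let l := dlen I in
  (Num.sqrt l)^-1 *
    (\1_(`[a, a + l / 2[%classic) x - \1_(`[a + l / 2, a + l[%classic) x).

Definition tensor (f1 f2 : R -> R) (z : R * R) : R := f1 z.1 * f2 z.2.

Definition rect w P : set (R * R) := ditv w.1 P.1 `*` ditv w.2 P.2.

Definition grid2 w : set (set (R * R)) := [set rect w P | P in [set: drect]].

Definition descendants2 w P i : set drect :=
  descendants w.1 P.1 i.1 `*` descendants w.2 P.2 i.2.

Definition haar2 w P : R * R -> R := tensor (haar w.1 P.1) (haar w.2 P.2).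

Definition haar_coef w (f : R * R -> R) P : R :=
  Rintegral mu2 setT (fun z => f z * haar2 w P z).

(** Test functions are the bounded measurable functions of bounded support:
    the class contains all Haar functions and all the tensor products
    on which Calderon-Zygmund conditions are tested. *)
Definition test1 (f : R -> R) : Prop :=
  measurable_fun setT f /\
  exists M : R, forall x, `|f x| <= M /\ (M < `|x| -> f x = 0).

Definition test2 (f : R * R -> R) : Prop :=
  measurable_fun setT f /\
  exists M : R, forall z, `|f z| <= M /\ (M < `|z| -> f z = 0).

(** The dyadic system is left free: no nonzero function has
    finitely many nonzero coefficients in almost every random system. *)
Definition finite_haar (f : R * R -> R) : Prop :=
  exists w, finite_set [set P | haar_coef w f P != 0].

Definition indic1 (V : set R) (x : R) : R := \1_V x.

Definition haar_mass w i (f : R * R -> R) P : \bar R :=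
  (\esum_(Q in descendants2 w P i) `|haar_coef w f Q|%:E)%E.

Definition square_fun w i j (f : R * R -> R) (y : R * R) : \bar R :=
  sqrte (\esum_(P in [set: drect])
    (haar_mass w i f P ^+ 2 *
     \esum_(Q in descendants2 w P j)
       (tensor (fun x => indic1 (ditv w.1 Q.1) x / dlen Q.1)
               (fun x => indic1 (ditv w.2 Q.2) x / dlen Q.2) y)%:E))%E.

Definition mean (F : R * R -> \bar R) (A : set (R * R)) : \bar R :=
  ((fine (mu2 A))^-1%:E * \int[mu2]_(y in A) F y)%E.

Definition sparse (eta : R) (L : set (set (R * R))) : Prop :=
  exists E : set (R * R) -> set (R * R),
    (forall A, L A ->
       [/\ measurable (E A), E A `<=` A & (eta%:E * mu2 A < mu2 (E A))%E]) /\
    trivIset L E.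

(** Sum of an absolutely summable family of signed terms. *)
Definition ssum (K : choiceType) (D : set K) (u : K -> \bar R) : \bar R :=
  (\esum_(k in D) u^\+ k - \esum_(k in D) u^\- k)%E.

(** Triples [(P, Q, S)] with [P] in [(S)_i] and [Q] in [(S)_j]. *)
Definition shift_triples w i j : set (drect * drect * drect) :=
  [set t | descendants2 w t.2 i t.1.1 /\ descendants2 w t.2 j t.1.2].

Definition shift_coefs w i j (a : drect -> drect -> drect -> R) : Prop :=
  forall P Q S, descendants2 w S i P -> descendants2 w S j Q ->
    `|a P Q S| <= 2 `^ (- (i.1 + j.1 + i.2 + j.2)%N%:R / 2).

(** The pairing <T^{i,j} f, g> of the shift with coefficients [a]. The series
    defining T^{i,j} f converges unconditionally in L^2, so it may be paired
    with [g] term by term. *)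
Definition shift_pairing w i j (a : drect -> drect -> drect -> R)
    (f g : R * R -> R) : \bar R :=
  ssum (shift_triples w i j) (fun t =>
    (a t.1.1 t.1.2 t.2 * haar_coef w f t.1.1 * haar_coef w g t.1.2)%:E).

Definition decay (delta : R) i j : R :=
  2 `^ (- ((maxn i.1 j.1)%:R * delta / 2)) *
  2 `^ (- ((maxn i.2 j.2)%:R * delta / 2)).

(** A linear operator is given weakly: it sends a test function [f] to a linear
    functional on test functions, and [T f g] is <Tf, g>. *)
Definition operator := (R * R -> R) -> (R * R -> R) -> R.

Definition linear_operator (T : operator) : Prop :=
  (forall (c : R) f f' g, test2 f -> test2 f' -> test2 g ->
     T (fun z => c * f z + f' z) g = c * T f g + T f' g) /\
  (forall (c : R) f g g', test2 f -> test2 g -> test2 g' ->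
     T f (fun z => c * g z + g' z) = c * T f g + T f g').

Definition spt (f : R -> R) : set R := closure [set x | f x != 0].

Definition bounded_interval (V : set R) : Prop :=
  [/\ is_interval V, bounded_set V & V° !=set0].

Definition len (V : set R) : R := fine (mu V).

Definition adapted (V : set R) (u : R -> R) : Prop :=
  [/\ measurable_fun setT u, (forall x, ~ V x -> u x = 0),
      (forall x, `|u x| <= 1) & Rintegral mu setT u = 0].

Definition holder_factor (delta t s : R) : R :=
  `|t| `^ delta / `|s| `^ (1 + delta).

Record full_kernel (C0 delta : R) (K : R * R -> R * R -> R) : Prop := {
  kernel_size : forall x1 x2 y1 y2, x1 != y1 -> x2 != y2 ->
    `|K (x1, x2) (y1, y2)| <= C0 * `|x1 - y1|^-1 * `|x2 - y2|^-1;
  kernel_holder_yy : forall x1 x2 y1 y2 y1' y2', x1 != y1 -> x2 != y2 ->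
    `|y1 - y1'| <= `|x1 - y1| / 2 -> `|y2 - y2'| <= `|x2 - y2| / 2 ->
    `|K (x1, x2) (y1, y2) - K (x1, x2) (y1, y2')
      - K (x1, x2) (y1', y2) + K (x1, x2) (y1', y2')|
    <= C0 * holder_factor delta (y1 - y1') (x1 - y1)
          * holder_factor delta (y2 - y2') (x2 - y2);
  kernel_holder_xx : forall x1 x2 y1 y2 x1' x2', x1 != y1 -> x2 != y2 ->
    `|x1 - x1'| <= `|x1 - y1| / 2 -> `|x2 - x2'| <= `|x2 - y2| / 2 ->
    `|K (x1, x2) (y1, y2) - K (x1, x2') (y1, y2)
      - K (x1', x2) (y1, y2) + K (x1', x2') (y1, y2)|
    <= C0 * holder_factor delta (x1 - x1') (x1 - y1)
          * holder_factor delta (x2 - x2') (x2 - y2);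
  kernel_holder_xy : forall x1 x2 y1 y2 x1' y2', x1 != y1 -> x2 != y2 ->
    `|x1 - x1'| <= `|x1 - y1| / 2 -> `|y2 - y2'| <= `|x2 - y2| / 2 ->
    `|K (x1, x2) (y1, y2) - K (x1, x2) (y1, y2')
      - K (x1', x2) (y1, y2) + K (x1', x2) (y1, y2')|
    <= C0 * holder_factor delta (x1 - x1') (x1 - y1)
          * holder_factor delta (y2 - y2') (x2 - y2);
  kernel_holder_yx : forall x1 x2 y1 y2 y1' x2', x1 != y1 -> x2 != y2 ->
    `|y1 - y1'| <= `|x1 - y1| / 2 -> `|x2 - x2'| <= `|x2 - y2| / 2 ->
    `|K (x1, x2) (y1, y2) - K (x1, x2') (y1, y2)
      - K (x1, x2) (y1', y2) + K (x1, x2') (y1', y2)|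
    <= C0 * holder_factor delta (y1 - y1') (x1 - y1)
          * holder_factor delta (x2 - x2') (x2 - y2);
  kernel_mixed_y1 : forall x1 x2 y1 y2 y1', x1 != y1 -> x2 != y2 ->
    `|y1 - y1'| <= `|x1 - y1| / 2 ->
    `|K (x1, x2) (y1, y2) - K (x1, x2) (y1', y2)|
    <= C0 * holder_factor delta (y1 - y1') (x1 - y1) * `|x2 - y2|^-1;
  kernel_mixed_x1 : forall x1 x2 y1 y2 x1', x1 != y1 -> x2 != y2 ->
    `|x1 - x1'| <= `|x1 - y1| / 2 ->
    `|K (x1, x2) (y1, y2) - K (x1', x2) (y1, y2)|
    <= C0 * holder_factor delta (x1 - x1') (x1 - y1) * `|x2 - y2|^-1;
  kernel_mixed_y2 : forall x1 x2 y1 y2 y2', x1 != y1 -> x2 != y2 ->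
    `|y2 - y2'| <= `|x2 - y2| / 2 ->
    `|K (x1, x2) (y1, y2) - K (x1, x2) (y1, y2')|
    <= C0 * `|x1 - y1|^-1 * holder_factor delta (y2 - y2') (x2 - y2);
  kernel_mixed_x2 : forall x1 x2 y1 y2 x2', x1 != y1 -> x2 != y2 ->
    `|x2 - x2'| <= `|x2 - y2| / 2 ->
    `|K (x1, x2) (y1, y2) - K (x1, x2') (y1, y2)|
    <= C0 * `|x1 - y1|^-1 * holder_factor delta (x2 - x2') (x2 - y2) }.

Record cz_kernel (C delta : R) (k : R -> R -> R) : Prop := {
  cz_size : forall x y, x != y -> `|k x y| <= C * `|x - y|^-1;
  cz_holder_y : forall x y y', x != y -> `|y - y'| <= `|x - y| / 2 ->
    `|k x y - k x y'| <= C * holder_factor delta (y - y') (x - y);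
  cz_holder_x : forall x y x', x != y -> `|x - x'| <= `|x - y| / 2 ->
    `|k x y - k x' y| <= C * holder_factor delta (x - x') (x - y) }.

Definition full_kernel_rep (T : operator) (C0 delta : R) : Prop :=
  exists K : R * R -> R * R -> R, full_kernel C0 delta K /\
    forall f1 f2 g1 g2, test1 f1 -> test1 f2 -> test1 g1 -> test1 g2 ->
      spt f1 `&` spt g1 = set0 -> spt f2 `&` spt g2 = set0 ->
      ((T (tensor f1 f2) (tensor g1 g2))%:E =
       \int[mu2]_x \int[mu2]_y
         (K x y * tensor f1 f2 y * tensor g1 g2 x)%:E)%E.

(** An operator seen through its action on tensor products: [B f1 f2 g1 g2] is
    <T(f1 (x) f2), g1 (x) g2>. *)
Definition tensor_form := (R -> R) -> (R -> R) -> (R -> R) -> (R -> R) -> R.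

Definition on_tensors (T : operator) : tensor_form :=
  fun f1 f2 g1 g2 => T (tensor f1 f2) (tensor g1 g2).

Definition adjoint (B : tensor_form) : tensor_form :=
  fun f1 f2 g1 g2 => B g1 g2 f1 f2.

Definition partial_adjoint (B : tensor_form) : tensor_form :=
  fun f1 f2 g1 g2 => B g1 f2 f1 g2.

Definition swap_variables (B : tensor_form) : tensor_form :=
  fun f1 f2 g1 g2 => B f2 f1 g2 g1.

(** [k f2 g2] and [c f2 g2] are the partial kernel and its constant. *)
Definition partial_kernel_rep (B : tensor_form) (C0 delta : R) : Prop :=
  exists (k : (R -> R) -> (R -> R) -> R -> R -> R)
         (c : (R -> R) -> (R -> R) -> R),
    [/\ forall f2 g2, test1 f2 -> test1 g2 ->
          cz_kernel (c f2 g2) delta (k f2 g2),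
        forall f1 f2 g1 g2, test1 f1 -> test1 f2 -> test1 g1 -> test1 g2 ->
          spt f1 `&` spt g1 = set0 ->
          ((B f1 f2 g1 g2)%:E =
           \int[mu]_x \int[mu]_y (k f2 g2 x y * f1 y * g1 x)%:E)%E
      & forall V u, bounded_interval V -> adapted V u ->
          c (indic1 V) (indic1 V) + c (indic1 V) u + c u (indic1 V)
          <= C0 * len V].

Definition symm_itv (n : nat) : set R := `[- n%:R, n%:R]%classic.

(** <T1, h1 (x) h2>, as the limit of <T(1_A), h1 (x) h2> along the squares
    A = [-n, n]^2. *)
Definition one_approx (B : tensor_form) (h1 h2 : R -> R) (n : nat) : R :=
  B (indic1 (symm_itv n)) (indic1 (symm_itv n)) h1 h2.

(** Product BMO, for a distribution known through its Haar coefficients: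
    the Chang-Fefferman Carleson condition, uniformly in the dyadic system. *)
Definition product_BMO (b : coins * coins -> drect -> R) : Prop :=
  exists C : R, forall w (Omega : set (R * R)),
    open Omega -> (mu2 Omega < +oo)%E ->
    (\esum_(P in [set P | rect w P `<=` Omega]) (b w P ^+ 2)%:E
     <= C%:E * mu2 Omega)%E.

Definition one_in_BMO (B : tensor_form) : Prop :=
  (forall w P, cvgn (one_approx B (haar w.1 P.1) (haar w.2 P.2))) /\
  product_BMO (fun w P => limn (one_approx B (haar w.1 P.1) (haar w.2 P.2))).

Definition cancellation (B : tensor_form) (C0 : R) : Prop :=
  forall V W, bounded_interval V -> bounded_interval W ->
    let v := indic1 V in let u := indic1 W in
    let bound := C0 * len V * len W in
    [/\ `|B v u v u| <= bound,
        forall a, adapted V a -> `|B a u v u| <= bound /\ `|B v u a u| <= bound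
      & forall b, adapted W b ->
          `|B v b v u| <= bound /\ `|B v u v b| <= bound].

Definition journe (T : operator) : Prop :=
  linear_operator T /\
  let B := on_tensors T in
  exists C0 delta : R, 0 < delta <= 1 /\
    [/\ full_kernel_rep T C0 delta,
        partial_kernel_rep B C0 delta,
        partial_kernel_rep (swap_variables B) C0 delta,
        [/\ one_in_BMO B, one_in_BMO (adjoint B),
            one_in_BMO (partial_adjoint B)
          & one_in_BMO (adjoint (partial_adjoint B))]
      & cancellation B C0].

(** Martikainen's dyadic representation with cancellative shifts only. The
    library integral needs no measurability in [w]: for nonnegative integrands
    it is the supremum over the simple functions below. *)
Definition paraproduct_free (Pr : probability coins R) (T : operator) : Prop :=
  exists (delta CT : R)
    (a : coins * coins -> nat * nat -> nat * nat ->
         drect -> drect -> drect -> R),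
    [/\ 0 < delta,
        forall w i j, shift_coefs w i j (a w i j)
      & forall f g, test2 f -> test2 g ->
          ((T f g)%:E = CT%:E * \int[Pr]_w1 \int[Pr]_w2
             ssum [set: (nat * nat) * (nat * nat)] (fun ij =>
               (decay delta ij.1 ij.2)%:E *
               shift_pairing (w1, w2) ij.1 ij.2 (a (w1, w2) ij.1 ij.2) f g))%E].

Definition tau i j : R := 2^-1 ^+ (i.1 + i.2 + j.1 + j.2)%N.

Definition sparse_form w i j (f g : R * R -> R) (L : set (set (R * R))) :
    \bar R :=
  (\esum_(A in L)
     (mu2 A * mean (square_fun w i j f) A * mean (square_fun w j i g) A))%E.

End Defs.

(* Main.v *)
(** The coefficients of a shift are at most [tau^(1/2)], so the pairing is bounded
    by [tau^(1/2)] times the sum over R of [A_R B_R], where [A_R] and [B_R] are the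
    sums of the moduli of the Haar coefficients of [f] and [g] over the descendants
    of R. By Bessel's inequality that sum is finite, hence half of it is
    attained on a finite family, and by Cauchy-Schwarz
    [tau^(-1/2) sum_R A_R B_R 1_R / |R| <= F G], where [F] and [G] are the square
    functions truncated to that family.

    List the family by decreasing [lam_R = (F)_R (G)_R] and select R whenever at
    most half of it is covered by the rectangles selected before (Cordoba-Fefferman):
    the selected rectangles are sparse. By Chebyshev's inequality
    [F G <= 16 lam_R] on at least half of each R, so the sum is controlled by the
    integral of the maximum of [lam_R 1_R]. The rectangles with [lam_R > t] are
    half covered by the selected ones with [lam_R > t]; the weak type bound of the
    strong maximal function and summation by parts then replace the
    whole family by the selected one.

    All of this is pointwise in the random grids, so integrating over them only
    uses monotonicity, which holds for nonmeasurable integrands too. *)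

Require Import Defs.
From mathcomp Require Import all_boot all_order all_algebra.
From mathcomp Require Import all_classical all_reals all_analysis.
From mathcomp Require Import measurable_realfun.
From mathcomp Require Import ring lra zify.
Set Implicit Arguments.
Unset Strict Implicit.
Unset Printing Implicit Defensive.
Import Order.TTheory GRing.Theory Num.Theory.
Import numFieldNormedType.Exports.
Import HBNNSimple.
Local Open Scope classical_set_scope.
Local Open Scope ring_scope.

(** * Sums and integrals of extended reals *)

Section ExtendedReals.
Variable R : realType.
Local Open Scope ereal_scope.

(** A finite [z] forces [x] and [y] to be finite, and for [z = +oo] the bound is trivial, so the
    value given to [+oo - +oo] does no harm. *)
Lemma abse_sub_le (x y z : \bar R) :
  0 <= x <= z -> 0 <= y <= z -> `|x - y| <= z.
Proof.
case: z => [z| |]; last 2 first.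
- by move=> *; rewrite leey.
- by move=> /andP[x0 /(le_trans x0)]; rewrite leeNy_eq.
case: x => [x| |]; rewrite ?leye_eq ?andbF//.
case: y => [y| |]; rewrite ?leye_eq ?andbF// => /andP[x0 xz] /andP[y0 yz].
rewrite -EFinB abse_EFin !lee_fin in x0 xz y0 yz *.
by rewrite ler_norml lerBlDr lerBrDr (le_trans _ x0) ?(le_trans xz) ?lerDl//
  addrC subr_le0.
Qed.

Lemma ge0_esumZl_le (I : choiceType) (D : set I) (x : \bar R) (a : I -> \bar R) :
  0 <= x -> (forall i, 0 <= a i) ->
  \esum_(i in D) (x * a i) <= x * \esum_(i in D) a i.
Proof.
move=> x0 a0; apply: ge_ereal_sup => _ [X [fX XD] <-].
rewrite -ge0_mule_fsumr//; apply: lee_wpmul2l => //.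
by apply: esum_ge; exists X.
Qed.

Lemma abse_ssum_le (K : choiceType) (D : set K) (u : K -> \bar R) :
  `|ssum D u| <= \esum_(k in D) `|u k|.
Proof.
have posle k : u^\+ k <= `|u k|.
  by rewrite -/((abse \o u) k) fune_abse leeDl// funeneg_ge0.
have negle k : u^\- k <= `|u k|.
  by rewrite -/((abse \o u) k) fune_abse leeDr// funepos_ge0.
by apply: abse_sub_le; apply/andP; split;
  do ?[by apply: esum_ge0 => k _; rewrite ?funepos_ge0 ?funeneg_ge0];
  apply: le_esum.
Qed.

End ExtendedReals.

Section NonmeasurableIntegral.
Context d (T : measurableType d) (R : realType) (mu : {measure set T -> \bar R}).
Local Open Scope ereal_scope.

(** The integral of a nonnegative function is a supremum over the simple functions below it, and
    those below [f] are below [g]. *)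
Lemma ge0_le_integral_nonmeasurable (D : set T) (f g : T -> \bar R) :
  (forall x, 0 <= f x) -> (forall x, f x <= g x) ->
  \int[mu]_(x in D) f x <= \int[mu]_(x in D) g x.
Proof.
move=> f0 fg; have g0 x : 0 <= g x by exact: le_trans (f0 x) (fg x).
rewrite ge0_integralE//; rewrite [leRHS]ge0_integralE//.
apply: le_ereal_sup => _ [h hf <-]; exists h => // x.
by apply: le_trans (hf x) _; rewrite /patch; case: ifP.
Qed.

(** A simple function below [k f], divided by [k], is a simple function below [f]. *)
Lemma ge0_integralZl_le (f : T -> \bar R) (k : R) :
  (0 < k)%R -> (forall x, 0 <= f x) ->
  \int[mu]_x (k%:E * f x) <= k%:E * \int[mu]_x f x.
Proof.
move=> k0 f0; rewrite ge0_integralTE; last first.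
  by move=> x; rewrite mule_ge0// lee_fin ltW.
apply: ge_ereal_sup => _ [h hf <-].
have ki0 : (0 <= k^-1)%R by rewrite invr_ge0 ltW.
have -> : sintegral mu h = k%:E * (k^-1%:E * sintegral mu h).
  by rewrite muleA -EFinM divff ?mul1e// gt_eqF.
rewrite lee_pmul2l ?lte_fin// -sintegralrM ge0_integralTE//.
apply: ereal_sup_ubound; exists (scale_nnsfun h ki0) => //= x.
by rewrite -(@lee_pmul2l _ k%:E) ?lte_fin// -EFinM mulrA divff ?mul1r ?gt_eqF.
Qed.

(** The integrals of the positive and the negative part both lie between 0 and the right-hand side,
    hence so does the modulus of their difference. *)
Lemma abse_integral_le (f : T -> \bar R) :
  `|\int[mu]_x f x| <= \int[mu]_x `|f x|.
Proof.
have le_pos : \int[mu]_x f^\+ x <= \int[mu]_x `|f x|.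
  apply: ge0_le_integral_nonmeasurable => x; first exact: funepos_ge0.
  by rewrite -/((abse \o f) x) fune_abse leeDl// funeneg_ge0.
have le_neg : \int[mu]_x f^\- x <= \int[mu]_x `|f x|.
  apply: ge0_le_integral_nonmeasurable => x; first exact: funeneg_ge0.
  by rewrite -/((abse \o f) x) fune_abse leeDr// funepos_ge0.
rewrite [X in `|X|]integralE.
by apply: abse_sub_le; rewrite ?le_pos ?le_neg andbT integral_ge0.
Qed.

End NonmeasurableIntegral.

(** * Random dyadic grids *)

Section Grid.
Variable R : realType.
Implicit Types (eta : coins) (I J : dyad).
Local Notation dlen := (@dlen R).
Local Notation dleft := (@dleft R).
Local Notation ditv := (@ditv R).

Lemma dlen_gt0 I : 0 < dlen I.
Proof. by rewrite /Defs.dlen exprz_gt0. Qed.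

Lemma dlen_succ (m n n' : int) : dlen (m + 1, n) = dlen (m, n') / 2.
Proof.
by rewrite /Defs.dlen /= opprD expfzDr ?pnatr_eq0.
Qed.

Lemma dlen_add (m n n' : int) (k : nat) :
  dlen (m + k%:Z, n) = dlen (m, n') / 2 ^+ k.
Proof.
by rewrite /Defs.dlen /= opprD expfzDr ?pnatr_eq0// -exprnN.
Qed.

Lemma cvg_grid_shift eta (m : int) : cvgn (series (fun n : nat =>
  (2 : R) ^ (- (m + 1 + n%:Z)) * (eta (m + 1 + n%:Z))%:R)).
Proof.
apply: (@series_le_cvg _ _ (geometric (2 ^ (- (m + 1))) 2^-1)).
- by move=> n; rewrite mulr_ge0// exprz_ge0.
- by move=> n; rewrite /= mulr_ge0 ?exprn_ge0 ?exprz_ge0 ?invr_ge0.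
- move=> n /=; rewrite opprD expfzDr ?pnatr_eq0// -exprnN exprVn.
  rewrite -[leRHS]mulr1 ler_wpM2l//; last by case: eta.
  by rewrite mulr_ge0 ?exprz_ge0 ?invr_ge0 ?exprn_ge0.
- by apply: is_cvg_geometric_series; rewrite ger0_norm ?invr_ge0// invf_lt1 ?ltr1n.
Qed.

Lemma grid_shift_succ eta (m : int) :
  grid_shift R eta m =
  2 ^ (- (m + 1)) * (eta (m + 1))%:R + grid_shift R eta (m + 1).
Proof.
rewrite /grid_shift; set u := fun n : nat => _; set v := fun n : nat => _.
have uv n : u n.+1 = v n.
  by rewrite /u /v (_ : m + 1 + n.+1%:Z = m + 1 + 1 + n%:Z) //; lia.
have -> : 2 ^ (- (m + 1)) * (eta (m + 1))%:R = u 0%N by rewrite /u addr0.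
have cu : cvgn (series u) by exact: cvg_grid_shift.
have cv : cvgn (series v) by exact: cvg_grid_shift.
apply/cvg_lim => //.
rewrite -(cvg_shiftS (series u)).
rewrite (_ : [sequence _]_n = cst (u 0%N) \+ series v); last first.
  apply/funext => n /=; rewrite /series /= big_nat_recl//; congr (_ + _).
  by apply: eq_bigr => i _.
by apply: cvgD => //; exact: cvg_cst.
Qed.

Lemma dleft_succ eta (m n : int) :
  dleft eta (m, n) = dleft eta (m + 1, n * 2 + (eta (m + 1))%:Z).
Proof.
rewrite /Defs.dleft /= grid_shift_succ addrA; congr (_ + _).
rewrite (dlen_succ m _ n) [2 ^ _](dlen_succ m 0 n) rmorphD rmorphM /=.
by rewrite mulrDl; congr (_ + _); [field|rewrite mulrC].
Qed.

Lemma dleft_next eta (m n k : int) :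
  dleft eta (m, n + k) = dleft eta (m, n) + k%:~R * dlen (m, n).
Proof. by rewrite /Defs.dleft /= rmorphD /=; rewrite /Defs.dlen /=; ring. Qed.

(** Passing to the next level, the shift of the grid loses the digit
    [eta (m + 1)], which the index absorbs. *)
Definition dyad_half eta I (b : bool) : dyad :=
  (I.1 + 1, I.2 * 2 + (eta (I.1 + 1))%:Z + b%:Z).

Lemma ditv_left_half eta I :
  ditv eta (dyad_half eta I false) =
  `[dleft eta I, dleft eta I + dlen I / 2[%classic.
Proof.
by case: I => m n; rewrite /Defs.ditv /dyad_half /= addr0 -dleft_succ (dlen_succ m _ n).
Qed.

Lemma ditv_right_half eta I :
  ditv eta (dyad_half eta I true) =
  `[dleft eta I + dlen I / 2, dleft eta I + dlen I[%classic.
Proof.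
case: I => m n; rewrite /Defs.ditv /dyad_half /= dleft_next -dleft_succ.
by rewrite !(dlen_succ m _ n) mul1r -(addrA (dleft _ _)) -splitr.
Qed.

Lemma ditvP eta I (y : R) :
  ditv eta I y <-> dleft eta I <= y < dleft eta I + dlen I.
Proof. by rewrite /Defs.ditv /= in_itv. Qed.

Lemma ditv_cover eta (m : int) (y : R) : exists n, ditv eta (m, n) y.
Proof.
pose z := (y - grid_shift R eta m) / dlen (m, 0).
exists (Num.floor z); apply/ditvP.
have := floor_le z; have := floorD1_gt z.
set n := Num.floor z; rewrite rmorphD /=.
have l0 := dlen_gt0 (m, 0).
rewrite ltr_pdivrMr// ler_pdivlMr// => h1 h2.
rewrite /Defs.dleft /= -[dlen (m, n)]/(dlen (m, 0)); apply/andP; split.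
  by rewrite -lerBrDr.
by move: h1; rewrite ltrBlDr mulrDl mul1r addrAC.
Qed.

Lemma ditv_same_level eta (m n n' : int) (y : R) :
  ditv eta (m, n) y -> ditv eta (m, n') y -> n = n'.
Proof.
wlog nn' : n n' / n <= n'.
  by move=> h; have [/h//|/ltW/h h' ? ?] := leP n n'; exact/esym/h'.
move=> /ditvP/andP[_ h1] /ditvP/andP[h2 _].
apply/eqP; rewrite eq_le nn' /= -ltzD1.
have := le_lt_trans h2 h1; rewrite -[n'](subrK n) addrC dleft_next.
rewrite ltrD2l -[ltRHS]mul1r ltr_pM2r ?dlen_gt0//.
by rewrite (ltr_int _ _ 1); lia.
Qed.

Lemma ditv_nonempty eta I : ditv eta I (dleft eta I).
Proof. by apply/ditvP; rewrite lexx ltrDl dlen_gt0. Qed.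

Lemma ditv_half_sub eta I b : ditv eta (dyad_half eta I b) `<=` ditv eta I.
Proof.
have l0 := dlen_gt0 I.
by case: b; rewrite ?ditv_left_half ?ditv_right_half => y /=;
  rewrite /Defs.ditv /= !in_itv /=; lra.
Qed.

Lemma halfP eta J : exists I b, J = dyad_half eta I b /\ I.1 = J.1 - 1.
Proof.
(* Inverting [dyad_half]: once the digit [eta m] is removed, the quotient by 2 is the index of the
   parent and the remainder tells which half. *)
case: J => m n; pose e := n - (eta m)%:Z.
exists (m - 1, (e %/ 2)%Z), ((e %% 2)%Z == 1); split => //.
rewrite /dyad_half /= subrK; congr pair.
have := divz_eq e 2; have := @modz_ge0 e 2 isT; have := @ltz_pmod e 2 isT.
rewrite /e; case: eqP => /=; lia.
Qed.

Lemma ditv_ancestor eta (k : nat) (m n : int) :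
  exists n', ditv eta (m + k%:Z, n) `<=` ditv eta (m, n').
Proof.
elim: k n => [|k ih] n; first by exists n; rewrite addr0.
have [[m' n'] [b [e /= m'E]]] := halfP eta (m + k.+1%:Z, n).
have [n'' h] := ih n'; exists n''; apply: subset_trans h.
rewrite e (_ : m + k%:Z = m'); first exact: ditv_half_sub.
by rewrite m'E -addn1 PoszD; ring.
Qed.

(** The ancestor of [J] on the level of [I] shares a point with [I], and intervals of one level are
    disjoint, so this ancestor is [I]. *)
Lemma ditv_nested eta I J : I.1 <= J.1 -> ditv eta I `&` ditv eta J !=set0 ->
  ditv eta J `<=` ditv eta I.
Proof.
case: I J => [m n] [m' n'] /= mm' [y [yI yJ]].
have [k m'E] : exists k : nat, m' = m + k%:Z.
  by exists `|m' - m|%N; lia.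
have [n'' h] := ditv_ancestor eta k m n'; rewrite -m'E in h.
by rewrite (ditv_same_level yI (h _ yJ)).
Qed.

(** If [J] were longer, the point at distance [dlen I] from its left end would be in [J] but beyond
    [I]. *)
Lemma ditv_sub_dlen eta I J : ditv eta J `<=` ditv eta I -> dlen J <= dlen I.
Proof.
move=> JI; rewrite leNgt; apply/negP => lt.
have /ditvP/andP[a1 a2] := JI _ (ditv_nonempty eta J).
have /ditvP/andP[_] : ditv eta I (dleft eta J + dlen I).
  by apply: JI; apply/ditvP; rewrite lerDl ltW ?dlen_gt0//= ltrD2l.
by rewrite ltrD2r ltNge a1.
Qed.

Lemma dlen_inj I J : dlen I = dlen J -> I.1 = J.1.
Proof.
have h (A B : dyad) : dlen A = dlen B -> A.1 <= B.1.
  move=> e; rewrite leNgt; apply/negP => lt.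
  have : (2 : R) ^ (- A.1) < 2 ^ (- B.1) by rewrite ltr_eXz2l ?ltr1n ?ltrN2.
  by rewrite -[_ ^ (- A.1)]/(dlen A) -[_ ^ _]/(dlen B) e ltxx.
by move=> e; apply/eqP; rewrite eq_le !h.
Qed.

Lemma ditv_inj eta : injective (ditv eta).
Proof.
move=> I J e; have lE : dlen I = dlen J.
  by apply/eqP; rewrite eq_le !(@ditv_sub_dlen eta) ?e.
have {}lE := dlen_inj lE.
have := ditv_nonempty eta I; have := ditv_nonempty eta I; rewrite {2}e.
by case: I J lE {e} => [m n] [m' n'] /= -> h1 h2; rewrite (ditv_same_level h1 h2).
Qed.

Lemma descendants_cover eta I k (y : R) : ditv eta I y ->
  exists2 J, descendants R eta I k J & ditv eta J y.
Proof.
move=> yI; have [n yn] := ditv_cover eta (I.1 + k%:Z) y.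
exists (I.1 + k%:Z, n) => //; split => //.
by apply: ditv_nested; [rewrite lerDl|exists y].
Qed.

(** Left ends of two descendants are less than [dlen I] apart, which is [2 ^ k] steps of their
    level, so congruent indices are equal. Counting residues thus counts descendants without
    computing their indices. *)
Lemma descendants_residue eta I k J J' :
  descendants R eta I k J -> descendants R eta I k J' ->
  (J.2 == J'.2 %[mod 2 ^ k])%Z -> J = J'.
Proof.
case: J J' => [m n] [m' n'] [/= -> h] [/= -> h']; rewrite eqz_mod_dvd => nn'.
congr pair; move: nn' => /dvdzP[q /eqP].
rewrite subr_eq => /eqP qE.
have /ditvP/andP[a1 a2] := h _ (ditv_nonempty _ _).
have /ditvP/andP[b1 b2] := h' _ (ditv_nonempty _ _).
have : `|dleft eta (I.1 + k%:Z, n) - dleft eta (I.1 + k%:Z, n')| < dlen I.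
  by rewrite ltr_norml; apply/andP; split; lra.
rewrite qE [_ + n']addrC dleft_next [dleft _ _ + _]addrC addrK.
rewrite normrM (ger0_norm (ltW (dlen_gt0 _))).
case: (I) => i1 i2 /=; rewrite (dlen_add i1 _ i2) mulrA ltr_pdivrMr ?exprn_gt0//.
rewrite mulrC ltr_pM2l ?dlen_gt0// rmorphM normrM rmorphXn /=.
rewrite [`|2 ^+ k|]ger0_norm ?exprn_ge0//.
rewrite -[ltRHS]mul1r ltr_pM2r ?exprn_gt0// -intr_norm (ltr_int _ _ 1).
have -> : (`|q| < 1) = (q == 0) by lia.
by move=> /eqP ->; rewrite mul0r addr0.
Qed.

Lemma descendants_uniq eta I I' k J :
  descendants R eta I k J -> descendants R eta I' k J -> I = I'.
Proof.
case: I I' => [m n] [m' n'] [/= e1 h1] [/= e2 h2].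
have mm' : m = m' by move: e1; rewrite e2 => /addIr.
rewrite mm' in h1 *; congr pair.
exact: (ditv_same_level (h1 _ (ditv_nonempty _ _)) (h2 _ (ditv_nonempty _ _))).
Qed.

Lemma measurable_ditv eta I : measurable (ditv eta I).
Proof. exact: measurable_itv. Qed.

Lemma lebesgue_ditv eta I : lebesgue_measure (ditv eta I) = (dlen I)%:E.
Proof.
rewrite /Defs.ditv lebesgue_measure_itv /= lte_fin ltrDl dlen_gt0.
by rewrite -EFinB addrAC subrr add0r.
Qed.

End Grid.

(** * The strong maximal function *)

Lemma ge0_integral_sum_indic d (T : measurableType d) (R : realType)
    (mu : {measure set T -> \bar R}) (I : eqType) (s : seq I) (a : I -> R)
    (B : I -> set T) :
  (forall i, i \in s -> 0 <= a i) -> (forall i, i \in s -> measurable (B i)) ->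
  (\int[mu]_y (\sum_(i <- s) a i * \1_(B i) y)%:E =
   \sum_(i <- s) (a i)%:E * mu (B i))%E.
Proof.
move=> a0 mB.
under eq_integral do rewrite -sumEFin.
(* The absolute value and the conditional make every term nonnegative and measurable for all
   indices, not only for those in [s], as exchanging sum and integral requires. *)
rewrite (eq_integral (fun y => \sum_(i <- s)
    (`|a i| * \1_(if i \in s then B i else set0) y)%:E)%E); last first.
  move=> y _; rewrite !big_seq; apply: eq_bigr => i si.
  by rewrite si ger0_norm ?a0.
rewrite ge0_integral_sum//.
  rewrite !big_seq; apply: eq_bigr => i si; rewrite si ger0_norm ?a0//.
  under eq_integral do rewrite EFinM.
  have mBi : measurable (B i) by exact: mB.
  rewrite ge0_integralZl_EFin ?a0//.
  - by rewrite integral_indic ?setIT.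
  - by apply/measurable_EFinP; exact: measurable_indic.
move=> i; apply/measurable_EFinP; apply: measurable_funM => //.
by apply: measurable_indic; case: ifP => // /mB.
Qed.

Section Maximal.
Variable R : realType.
Local Notation mu := (@lebesgue_measure R).
Local Notation mu2 := (@lebesgue_measure R \x @lebesgue_measure R)%E.
Local Notation dlen := (@dlen R).
Local Notation ditv := (@ditv R).
Local Notation rect := (@rect R).

(** The product measure is defined through vertical sections; by uniqueness it may also be computed
    by horizontal ones. *)
Lemma lebesgue_prodE (X : set (R * R)) : measurable X ->
  mu2 X = (\int[mu]_y mu (ysection X y))%E.
Proof.
move=> mX; rewrite -[RHS]/((mu \x^ mu)%E X).
by apply: product_measure_unique => // A B mA mB; exact: product_measure2E.
Qed.

(** Intervals are inserted one at a time: one lying inside a kept interval is dropped, any other one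
    expels the kept intervals inside it. By nestedness the remaining ones are disjoint from it. *)
Lemma disjoint_subfamily eta (s : seq dyad) : exists t : seq dyad,
  [/\ {subset t <= s}, trivIset [set` t] (ditv eta) &
    \bigcup_(I in [set` s]) ditv eta I `<=` \bigcup_(I in [set` t]) ditv eta I].
Proof.
elim: s => [|I s [t [ts tt ut]]]; first by exists [::]; split.
have [[J tJ IJ]|noJ] := pselect (exists2 J, J \in t & ditv eta I `<=` ditv eta J).
  exists t; split=> //; first by move=> K /ts; rewrite inE orbC => ->.
  move=> y [K]; rewrite /= inE => /orP[/eqP -> /IJ yJ|sK yK]; first by exists J.
  by apply: ut; exists K.
pose t' := [seq J <- t | ~~ `[< ditv eta J `<=` ditv eta I >]].
exists (I :: t'); split.
- move=> K; rewrite !inE mem_filter => /orP[->//|/andP[_ /ts ->]].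
  by rewrite orbT.
- have h J : J \in t' -> ditv eta I `&` ditv eta J !=set0 -> I = J.
    rewrite mem_filter => /andP[/asboolP nJI tJ] IJ; exfalso.
    have [le|/ltW le] := leP I.1 J.1; first exact/nJI/(ditv_nested le IJ).
    by apply: noJ; exists J => //; apply: ditv_nested => //; rewrite setIC.
  move=> J K /=; rewrite !inE => /orP[/eqP ->|J'] /orP[/eqP ->|K'] //.
  + exact: h.
  + by move=> JI; apply/esym/h => //; rewrite setIC.
  + by apply: tt; move: J' K'; rewrite !mem_filter => /andP[_ ?] /andP[_ ?].
- move=> y [K]; rewrite /= inE => /orP[/eqP -> yI|sK yK].
    by exists I => //=; rewrite inE eqxx.
  have [J /= tJ yJ] : (\bigcup_(I in [set` t]) ditv eta I) y by apply: ut; exists K.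
  have [/asboolP JI|JI] := boolP `[< ditv eta J `<=` ditv eta I >].
    by exists I; [rewrite /= inE eqxx|exact: JI].
  by exists J => //=; rewrite inE mem_filter JI tJ orbT.
Qed.

(** The disjoint subfamily has the same union, and its parts of [E] are disjoint, so the quarter
    lengths add up to at most [mu E]. *)
Lemma weak_type1 eta (s : seq dyad) (E : set R) : measurable E ->
  (forall I, I \in s -> ((dlen I / 4)%:E <= mu (E `&` ditv eta I))%E) ->
  (mu (\bigcup_(I in [set` s]) ditv eta I) <= 4%:E * mu E)%E.
Proof.
move=> mE hs; have [t [ts tt ut]] := disjoint_subfamily eta s.
have ft : finite_set [set` t] by exact: finite_seq.
have fs : finite_set [set` s] by exact: finite_seq.
have mI (r : seq dyad) : measurable (\bigcup_(I in [set` r]) ditv eta I).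
  by apply: fin_bigcup_measurable => [|I _]; [exact: finite_seq|exact: measurable_ditv].
apply: (@le_trans _ _ (mu (\bigcup_(I in [set` t]) ditv eta I))).
  by apply: le_measure => //; rewrite inE; exact: mI.
rewrite measure_fin_bigcup//; last by move=> I _; exact: measurable_ditv.
apply: (@le_trans _ _ (4%:E * mu (E `&` \bigcup_(I in [set` t]) ditv eta I))%E).
  rewrite setI_bigcupr measure_fin_bigcup//; last 2 first.
  + exact: trivIset_setIl.
  + by move=> I _; apply: measurableI => //; exact: measurable_ditv.
  rewrite ge0_mule_fsumr; last by move=> I; exact: measure_ge0.
  apply: lee_fsum => // I /ts/hs h; rewrite [leLHS]lebesgue_ditv.
  apply: le_trans (lee_wpmul2l _ h) => //.
  by rewrite -EFinM lee_fin mulrC divfK ?pnatr_eq0.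
by apply: lee_wpmul2l => //; apply: le_measure => //; rewrite inE//; apply: measurableI => //; exact: mI.
Qed.

Lemma measurable_rect w P : measurable (rect w P).
Proof. by apply: measurableX; exact: measurable_ditv. Qed.

Definition area (P : drect) : R := dlen P.1 * dlen P.2.

Lemma area_gt0 P : 0 < area P.
Proof. by rewrite mulr_gt0 ?dlen_gt0. Qed.

Lemma lebesgue_rect w P : (mu2 (rect w P) = (area P)%:E)%E.
Proof.
rewrite /rect product_measure1E; try exact: measurable_ditv.
by rewrite EFinM [X in (X * _)%E]lebesgue_ditv [X in (_ * X)%E]lebesgue_ditv.
Qed.

Lemma rect_inj w : injective (rect w).
Proof.
suff h (P Q : drect) : rect w P = rect w Q ->
    ditv w.1 P.1 `<=` ditv w.1 Q.1 /\ ditv w.2 P.2 `<=` ditv w.2 Q.2.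
  move=> [I J] [I' J'] e; have [/= h1 h2] := h _ _ e; have [/= h3 h4] := h _ _ (esym e).
  by congr pair; apply: (@ditv_inj R); apply/seteqP; split; eassumption.
move=> e; split => y yP.
- by have [] : rect w Q (y, @dleft R w.2 P.2) by rewrite -e; split => //; exact: ditv_nonempty.
- by have [] : rect w Q (@dleft R w.1 P.1, y) by rewrite -e; split => //; exact: ditv_nonempty.
Qed.

(* A rectangle half filled by [U] has at least a quarter of its horizontal lines
   a quarter filled by [U], so the weak type estimate can be applied first along
   horizontal and then along vertical lines. *)
Lemma weak_type2 w (s : seq drect) (U : set (R * R)) : measurable U ->
  (forall P, P \in s -> ((area P / 2)%:E <= mu2 (U `&` rect w P))%E) ->
  (mu2 (\bigcup_(P in [set` s]) rect w P) <= 16%:E * mu2 U)%E.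
Proof.
move=> mU hs.
have mD : forall I, measurable (ditv w.1 I `*` setT : set (R * R)).
  by move=> I; apply: measurableX => //; exact: measurable_ditv.
(* [Y I] is the set of heights at which [U] fills a quarter of [I]. The set [W] below keeps from
   each rectangle the full-width lines at such heights, regardless of its vertical side. *)
pose Y (I : dyad) : set R :=
  [set y | ((dlen I / 4)%:E <= mu (ysection U y `&` ditv w.1 I))%E].
have secE I y : ysection (U `&` ditv w.1 I `*` setT) y = ysection U y `&` ditv w.1 I.
  by rewrite ysectionI in_ysectionX ?inE.
have mY I : measurable (Y I).
  have := measurable_fun_ysection mu (measurableI _ _ mU (mD I)).
  move=> /(_ measurableT `[(dlen I / 4)%:E, +oo[%classic).
  rewrite setTI (_ : _ @^-1` _ = Y I); first by apply; exact: emeasurable_itv.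
  by apply/seteqP; split => y; rewrite /Y /= in_itv /= andbT secE.
pose W := \bigcup_(P in [set` s]) (ditv w.1 P.1 `*` Y P.1).
have fs : finite_set [set` s] by exact: finite_seq.
have mW : measurable W.
  apply: fin_bigcup_measurable => // P _; apply: measurableX => //.
  exact: measurable_ditv.
have mV : measurable (\bigcup_(P in [set` s]) rect w P).
  by apply: fin_bigcup_measurable => // P _; exact: measurable_rect.
(* Along horizontal lines: the section of [W] at height [y] is a union of intervals that the section
   of [U] fills to a quarter. *)
have W4 : (mu2 W <= 4%:E * mu2 U)%E.
  rewrite !lebesgue_prodE// -ge0_integralZl//; last first.
    exact: measurable_fun_ysection.
  apply: ge0_le_integral => //.
  - exact: measurable_fun_ysection.
  - apply: emeasurable_funM => //; exact: measurable_fun_ysection.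
  move=> y _.
  pose sy := [seq P.1 | P <- s & y \in Y P.1].
  have -> : ysection W y = \bigcup_(I in [set` sy]) ditv w.1 I.
    apply/seteqP; split => x.
      move=> /set_mem[P sP [/= xP yP]].
      exists P.1 => //=; apply/mapP; exists P => //.
      by rewrite mem_filter sP mem_set.
    move=> [I /= /mapP[P]]; rewrite mem_filter => /andP[/set_mem yP sP] -> xP.
    by apply/mem_set; exists P.
  apply: weak_type1; first exact: measurable_ysection.
  by move=> I /mapP[P]; rewrite mem_filter => /andP[/set_mem yP _] ->.
apply: (@le_trans _ _ (4%:E * mu2 W)%E); last first.
  have -> : (16%:E = 4%:E * 4%:E :> \bar R)%E by rewrite -EFinM; congr EFin; lra.
  by rewrite -muleA lee_wpmul2l.
rewrite /product_measure1 -ge0_integralZl//; last first.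
  exact: measurable_fun_xsection.
apply: ge0_le_integral => //.
- exact: measurable_fun_xsection.
- apply: emeasurable_funM => //; exact: measurable_fun_xsection.
move=> x _ /=.
pose sx := [seq P.2 | P <- s & x \in ditv w.1 P.1].
have -> : xsection (\bigcup_(P in [set` s]) rect w P) x =
    \bigcup_(I in [set` sx]) ditv w.2 I.
  apply/seteqP; split => y.
    move=> /set_mem[P sP [/= xP yP]].
    exists P.2 => //=; apply/mapP; exists P => //.
    by rewrite mem_filter sP mem_set.
  move=> [I /= /mapP[P]]; rewrite mem_filter => /andP[/set_mem yP sP] -> xP.
  by apply/mem_set; exists P.
have mxW : measurable (xsection W x) by exact: measurable_xsection.
apply: weak_type1; first exact: mxW.
move=> I /mapP[P]; rewrite mem_filter => /andP[/set_mem xP sP] ->.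
have mJ : measurable (ditv w.2 P.2) by exact: measurable_ditv.
(* Along vertical lines it remains to see that [Y P.1] fills a quarter of [P.2]. *)
apply: (@le_trans _ _ (mu (Y P.1 `&` ditv w.2 P.2))); last first.
  apply: le_measure; rewrite ?inE.
  - exact: (measurableI _ _ (mY _) mJ).
  - exact: (measurableI _ _ mxW mJ).
  - by apply: setSI => y yP; apply/mem_set; exists P.
move: (hs P sP); rewrite lebesgue_prodE; last first.
  by apply: measurableI => //; exact: measurable_rect.
move=> hP.
have l1 := dlen_gt0 R P.1; have l2 := dlen_gt0 R P.2.
(* Majorant of the section lengths over [P.2]: [dlen P.1] at heights in [Y P.1], plus [dlen P.1 / 4]
   everywhere. Its integral is at least [area P / 2], and the second term only accounts for
   [area P / 4]. *)
pose a := fun b : bool => if b then dlen P.1 else dlen P.1 / 4.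
pose B := fun b : bool => if b then Y P.1 `&` ditv w.2 P.2 else ditv w.2 P.2.
have mB b : measurable (B b) by case: b => //; exact: measurableI.
have : (\int[mu]_y mu (ysection (U `&` rect w P) y) <=
  \int[mu]_y (\sum_(b <- [:: true; false]) a b * \1_(B b) y)%:E)%E.
  apply: ge0_le_integral => //.
  - apply: measurable_fun_ysection; apply: measurableI => //; exact: measurable_rect.
  - apply/measurable_EFinP; apply: measurable_sum => b; apply: measurable_funM => //.
    by apply: measurable_indic; exact: mB.
  move=> y _; rewrite big_cons big_seq1 /=.
  have [yP|nyP] := pselect (ditv w.2 P.2 y); last first.
    have -> : ysection (U `&` rect w P) y = set0.
      by apply/seteqP; split => z // /set_mem[_ [_ /nyP]].
    by rewrite measure0 lee_fin addr_ge0 ?mulr_ge0 ?divr_ge0// ltW.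
  have -> : ysection (U `&` rect w P) y = ysection U y `&` ditv w.1 P.1.
    by rewrite ysectionI in_ysectionX ?inE.
  rewrite [\1_(ditv _ _) y]indicE mem_set// mulr1.
  have [yY|nyY] := pselect (Y P.1 y).
    rewrite indicE mem_set// mulr1 (@le_trans _ _ (dlen P.1)%:E)//; last first.
      by rewrite lee_fin lerDl divr_ge0 ?ltW.
    rewrite -(lebesgue_ditv R w.1); apply: le_measure => //; rewrite inE.
      by apply: measurableI; [exact: measurable_ysection|exact: measurable_ditv].
    exact: measurable_ditv.
  rewrite indicE memNset; last by case.
  by rewrite mulr0 add0r ltW// ltNge; apply/negP.
rewrite ge0_integral_sum_indic; last 2 first.
- by move=> [] _; rewrite /a ?ltW// divr_gt0.
- by move=> b _; exact: mB.
have -> : (\sum_(b <- [:: true; false]) (a b)%:E * mu (B b) =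
    (dlen P.1)%:E * mu (Y P.1 `&` ditv w.2 P.2) + (dlen P.1 / 4 * dlen P.2)%:E)%E.
  by rewrite big_cons big_seq1 (EFinM (dlen P.1 / 4)) -(lebesgue_ditv R w.2 P.2).
move=> /(le_trans hP).
case: (mu (Y P.1 `&` _)) => [m| |]; rewrite ?leey//; last first.
  by rewrite gt0_muleNy ?lte_fin// addNye leeNy_eq.
rewrite -!EFinM -EFinD !lee_fin /area => h.
rewrite -(ler_pM2l l1); lra.
Qed.

End Maximal.

(** * Cordoba-Fefferman selection *)

(** Summation by parts for [u - v], which is nonnegative and starts at 0. The induction keeps the
    boundary term [lam m * (u m.+1 - v m.+1)], dropped at the end. *)
Lemma abel_le (R : realDomainType) (n : nat) (lam v u : nat -> R) :
  (forall k, (k < n)%N -> 0 <= lam k) ->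
  (forall k, (k.+1 < n)%N -> lam k.+1 <= lam k) ->
  (forall k, (k <= n)%N -> v k <= u k) -> v 0%N = u 0%N ->
  \sum_(0 <= k < n) lam k * (v k.+1 - v k) <=
  \sum_(0 <= k < n) lam k * (u k.+1 - u k).
Proof.
case: n => [|n] lam0 lamd vu vu0; first by rewrite !big_geq.
suff h m : (m <= n)%N -> lam m * (u m.+1 - v m.+1) <=
    \sum_(0 <= k < m.+1) lam k * (u k.+1 - u k) -
    \sum_(0 <= k < m.+1) lam k * (v k.+1 - v k).
  by rewrite -subr_ge0 (le_trans _ (h n _))// mulr_ge0 ?lam0// subr_ge0 vu.
elim: m => [|m ih] mn; first by rewrite !big_nat1 vu0; lra.
have {}ih := ih (ltnW mn).
rewrite big_nat_recr//= [X in _ <= _ - X]big_nat_recr//=.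
have := ler_wpM2r _ (lamd m mn); move=> /(_ (u m.+1 - v m.+1)).
rewrite subr_ge0 vu ?(leq_trans mn)// => /(_ isT).
lra.
Qed.

Section Selection.
Variable R : realType.
Local Notation mu2 := (@lebesgue_measure R \x @lebesgue_measure R)%E.
Local Notation rect := (@rect R).
Local Notation area := (@area R).
Variables (w : coins * coins) (r : nat -> drect).

Fixpoint selected_union (k : nat) : set (R * R) :=
  if k is k'.+1 then
    selected_union k' `|`
    (if (mu2 (selected_union k' `&` rect w (r k')) <= (area (r k') / 2)%:E)%E
     then rect w (r k') else set0)
  else set0.

Definition selected (k : nat) : bool :=
  (mu2 (selected_union k `&` rect w (r k)) <= (area (r k) / 2)%:E)%E.

Lemma selected_unionS k : selected_union k.+1 =
  selected_union k `|` (if selected k then rect w (r k) else set0).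
Proof. by []. Qed.

Lemma measurable_selected_union k : measurable (selected_union k).
Proof.
elim: k => [|k ih]; first exact: measurable0.
rewrite selected_unionS; apply: measurableU => //.
by case: ifP => // _; exact: measurable_rect.
Qed.

Lemma selected_union_sub j k : (j <= k)%N -> selected_union j `<=` selected_union k.
Proof.
move=> /subnK <-; elim: (k - j)%N => [//|i ih]; rewrite addSn selected_unionS.
exact: subset_trans ih (@subsetUl _ _ _).
Qed.

Lemma selected_sub j k : (j < k)%N -> selected j -> rect w (r j) `<=` selected_union k.
Proof.
move=> jk sj; apply: subset_trans (selected_union_sub jk).
by rewrite selected_unionS sj; exact: subsetUr.
Qed.

(** A selected rectangle is part of the union; a rejected one was more than half covered when it was
    rejected. *)
Lemma half_covered j k : (j < k)%N ->
  ((area (r j) / 2)%:E <= mu2 (selected_union k `&` rect w (r j)))%E.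
Proof.
move=> jk; have mI i j' : measurable (selected_union i `&` rect w (r j')).
  by apply: measurableI; [exact: measurable_selected_union|exact: measurable_rect].
have [sj|/negP nsj] := boolP (selected j).
  rewrite setIidr; last exact: selected_sub.
  by rewrite lebesgue_rect lee_fin; have := area_gt0 R (r j); lra.
have : ((area (r j) / 2)%:E <= mu2 (selected_union j `&` rect w (r j)))%E.
  by apply/ltW; rewrite ltNge; exact/negP.
move=> /le_trans; apply; apply: le_measure; rewrite ?inE.
- exact: mI.
- exact: mI.
- by apply: setSI; exact: selected_union_sub (ltnW jk).
Qed.

Lemma mu2_selected_union k :
  (mu2 (selected_union k) <= (\sum_(0 <= j < k | selected j) area (r j))%:E)%E.
Proof.
elim: k => [|k ih]; first by rewrite big_geq// measure0.
rewrite selected_unionS big_mkcond big_nat_recr//= -big_mkcond/= EFinD.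
apply: le_trans (measureU2 _ _ _) _.
- exact: measurable_selected_union.
- by case: ifP => // _; exact: measurable_rect.
apply: leeD => //; case: ifP => _; last by rewrite measure0.
by rewrite [leLHS]lebesgue_rect.
Qed.

Lemma mu2_union_le k :
  (mu2 (\big[setU/set0]_(j < k) rect w (r j)) <=
   (16 * \sum_(0 <= j < k | selected j) area (r j))%:E)%E.
Proof.
pose s := [seq r j | j <- iota 0 k].
have -> : \big[setU/set0]_(j < k) rect w (r j) = \bigcup_(P in [set` s]) rect w P.
  rewrite -(bigcup_mkord k (fun j => rect w (r j))); apply/seteqP; split => y [j /= jk yj].
    by exists (r j) => //=; apply: map_f; rewrite mem_iota.
  by move: jk yj => /mapP[i]; rewrite mem_iota => /= ik -> yi; exists i.
apply: le_trans (weak_type2 (measurable_selected_union k) _) _.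
  by move=> P /mapP[j]; rewrite mem_iota => /= jk ->; exact: half_covered.
by rewrite EFinM lee_wpmul2l// mu2_selected_union.
Qed.

(** A second occurrence of a selected rectangle is already fully covered, so it fails the test. *)
Lemma selected_inj : {in selected &, injective r}.
Proof.
move=> j k; wlog jk : j k / (j < k)%N.
  move=> h sj sk e; have [jk|kj|//] := ltngtP j k; first exact: h.
  by apply/esym; apply: h.
rewrite /in_mem/= => sj; rewrite /selected => + e.
rewrite setIidr; last by rewrite -e; exact: selected_sub.
by rewrite lebesgue_rect lee_fin => h; exfalso; have := area_gt0 R (r k); lra.
Qed.

(** The disjoint pieces are the parts not covered at the time of selection. They fill at least half
    of the rectangle; sparseness asks for a strict inequality, and 1/4 leaves room for it. *)
Lemma sparse_selected (n : nat) :
  sparse (4^-1 : R) [set rect w P | P in [set` [seq r j | j <- iota 0 n & selected j]]].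
Proof.
(* Pieces are indexed by sets, so the stage of selection is recovered existentially; it is unique by
   [selected_inj] and [rect_inj]. *)
pose E (A : set (R * R)) : set (R * R) :=
  [set y | exists j, [/\ selected j, rect w (r j) = A & (A `\` selected_union j) y]].
have EE j : selected j -> E (rect w (r j)) = rect w (r j) `\` selected_union j.
  move=> sj; apply/seteqP; split => [y [i [si e]]|y yj]; last by exists j.
  by rewrite (selected_inj si sj (rect_inj e)).
have mI j : measurable (selected_union j `&` rect w (r j)).
  by apply: measurableI; [exact: measurable_selected_union|exact: measurable_rect].
have mD j : measurable (rect w (r j) `\` selected_union j).
  by apply: measurableD; [exact: measurable_rect|exact: measurable_selected_union].
exists E; split.
  move=> _ [_ /mapP[j + ->] <-]; rewrite mem_filter => /andP[sj _].
  rewrite EE//; split; [exact: mD|exact: subDsetl|].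
  rewrite lebesgue_rect.
  have : (mu2 (rect w (r j)) <= (area (r j) / 2)%:E +
      mu2 (rect w (r j) `\` selected_union j))%E.
    apply: (@le_trans _ _ (mu2 ((selected_union j `&` rect w (r j)) `|`
      (rect w (r j) `\` selected_union j)))).
      apply: le_measure; rewrite ?inE//.
        exact: measurable_rect.
        by apply: measurableU; [exact: mI|exact: mD].
      by move=> y yj; have [?|?] := pselect (selected_union j y); [left|right].
    apply: le_trans (measureU2 _ _ _) _.
    - exact: mI.
    - exact: mD.
    - by rewrite leeD2r.
  rewrite lebesgue_rect; have := area_gt0 R (r j).
  case: (mu2 (_ `\` _)) => [m| |]; rewrite ?ltry//= -EFinD -EFinM lee_fin lte_fin; lra.
move=> _ _ [_ /mapP[j + ->] <-] [_ /mapP[k + ->] <-].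
rewrite !mem_filter => /andP[sj _] /andP[sk _]; rewrite !EE//.
wlog jk : j k sj sk / (j < k)%N.
  move=> h; have [jk|kj|->//] := ltngtP j k; first exact: h.
  by rewrite setIC => ?; apply/esym/h.
by move=> [y [[yj _] [_ ]]]; have /(_ _ yj) := selected_sub jk sj.
Qed.

End Selection.

(** * Comparison of a family of rectangles with its selected part *)

Section Core.
Variable R : realType.
Local Notation mu2 := (@lebesgue_measure R \x @lebesgue_measure R)%E.
Local Notation rect := (@rect R).
Local Notation area := (@area R).

(** On the [k]-th layer, [lam k] is the largest [lam j] over the rectangles
    containing the point. *)
Lemma sum_le_layers w (r : nat -> drect) (n : nat) (lam c : nat -> R)
    (H : R * R -> R) :
  (forall k, (k < n)%N -> 0 <= lam k) -> (forall k, (k < n)%N -> 0 <= c k) ->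
  (forall j k, (j <= k < n)%N -> lam k <= lam j) ->
  measurable_fun setT H ->
  (forall y, \sum_(0 <= k < n) c k * \1_(rect w (r k)) y <= H y) ->
  (forall k, (k < n)%N -> ((area (r k))%:E <=
     2%:E * mu2 (rect w (r k) `&` [set y | (H y <= 16 * lam k)%R]))%E) ->
  ((\sum_(0 <= k < n) c k * area (r k))%:E <=
   \sum_(0 <= k < n) (32 * lam k)%:E * mu2 (seqDU (fun j => rect w (r j)) k))%E.
Proof.
move=> lam0 c0 lamd mH cH half.
pose G k := rect w (r k) `&` [set y | (H y <= 16 * lam k)%R].
have mG k : measurable (G k).
  apply: measurableI; first exact: measurable_rect.
  have := mH measurableT `]-oo, (16 * lam k)%R]%classic.
  rewrite setTI (_ : _ @^-1` _ = [set y | (H y <= 16 * lam k)%R]).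
    by apply; exact: measurable_itv.
  by apply/seteqP; split => y /=; rewrite in_itv.
have mD k : measurable (seqDU (fun j => rect w (r j)) k).
  by apply: seqDU_measurable => j; exact: measurable_rect.
apply: (@le_trans _ _ (\sum_(0 <= k < n) (2 * c k)%:E * mu2 (G k))%E).
  rewrite -sumEFin !big_seq; apply: lee_sum => k; rewrite mem_index_iota /= => kn.
  have -> : ((2 * c k)%:E = (c k)%:E * 2%:E)%E by rewrite -EFinM mulrC.
  rewrite -muleA (EFinM (c k)).
  by apply: lee_wpmul2l; [rewrite lee_fin c0|exact: half].
have c2 k : k \in index_iota 0 n -> 0 <= 2 * c k.
  by rewrite mem_index_iota /= => kn; rewrite mulr_ge0 ?c0.
have lam32 k : k \in index_iota 0 n -> 0 <= 32 * lam k.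
  by rewrite mem_index_iota /= => kn; rewrite mulr_ge0 ?lam0.
rewrite -!ge0_integral_sum_indic//; last 2 first.
- by move=> k _; exact: mD.
- by move=> k _; exact: mG.
apply: ge0_le_integral_nonmeasurable => y.
  by rewrite lee_fin big_seq sumr_ge0// => k kn; rewrite mulr_ge0 ?c2.
rewrite lee_fin.
have R0 : 0 <= \sum_(0 <= k < n) 32 * lam k * \1_(seqDU (fun j => rect w (r j)) k) y.
  by rewrite big_seq sumr_ge0// => k kn; rewrite mulr_ge0 ?lam32.
have [[j jn yj]|none] := pselect (exists2 j, (j < n)%N & G j y); last first.
  rewrite big_seq big1// => k; rewrite mem_index_iota /= => kn.
  by rewrite indicE memNset ?mulr0// => yk; apply: none; exists k.
(* Let [k] be the first rectangle containing [y]: then [y] is on the layer [k], and [lam k] is the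
   largest value at [y]. As [y] is in the good part of [r j] with [k <= j],
   [H y <= 16 * lam j <= 16 * lam k]; the factor 2 of the good parts turns 16 into 32. *)
have exk : exists k, y \in rect w (r k) by exists j; apply/mem_set; exact: yj.1.
case: (ex_minnP exk) => k /set_mem ryk kmin.
have kj : (k <= j)%N by apply: kmin; apply/mem_set; exact: yj.1.
have Dk : seqDU (fun j => rect w (r j)) k y.
  split => //; rewrite -(bigcup_mkord k (fun j => rect w (r j))) => -[i /= ik yi].
  by have := kmin i (mem_set yi); rewrite leqNgt ik.
apply: (@le_trans _ _ (2 * H y)).
  apply: (@le_trans _ _ (2 * \sum_(0 <= k < n) c k * \1_(rect w (r k)) y)).
    rewrite mulr_sumr !big_seq; apply: ler_sum => i; rewrite mem_index_iota /= => kn.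
    rewrite -mulrA ler_pM2l// ler_wpM2l ?c0// !indicE ler_nat.
    by case: (y \in G i) / boolP => // /set_mem[/mem_set -> _].
  by rewrite ler_pM2l.
apply: (@le_trans _ _ (32 * lam k)).
  have [_ /=] := yj; have := lamd k j; rewrite kj jn => /(_ isT); lra.
rewrite (bigD1_seq k) ?mem_index_iota ?iota_uniq ?(leq_ltn_trans kj)//=.
rewrite indicE mem_set// mulr1 lerDl big_seq_cond sumr_ge0// => i.
by move=> /andP[kn _]; rewrite mulr_ge0 ?lam32.
Qed.

(** The constant is 32 from the layers times 16 from the weak type bound. *)
Lemma sparse_selection w (s : seq drect) (lam c : drect -> R) (H : R * R -> R) :
  (forall P, P \in s -> 0 <= lam P) -> (forall P, P \in s -> 0 <= c P) ->
  measurable_fun setT H ->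
  (forall y, \sum_(P <- s) c P * \1_(rect w P) y <= H y) ->
  (forall P, P \in s -> ((area P)%:E <=
     2%:E * mu2 (rect w P `&` [set y | (H y <= 16 * lam P)%R]))%E) ->
  exists t : seq drect, [/\ uniq t, {subset t <= s},
    sparse (4^-1 : R) [set rect w P | P in [set` t]] &
    \sum_(P <- s) c P * area P <= 512 * \sum_(P <- t) lam P * area P].
Proof.
move=> lam0 c0 mH cH half.
have [->|s0] := eqVneq s [::].
  exists [::]; split => //; last by rewrite !big_nil mulr0.
  exists (fun A => A); split; first by move=> A [].
  by move=> A B [].
have [P0 _] : exists P, P \in s by case: s s0 {lam0 c0 cH half} => // P s _; exists P; rewrite inE eqxx.
pose s' := sort (fun P Q => lam Q <= lam P) s.
have ps : perm_eq s' s by rewrite perm_sort.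
pose n := size s'; pose r := nth P0 s'.
have rs k : (k < n)%N -> r k \in s by move=> kn; rewrite -(perm_mem ps) mem_nth.
have sumE (F : drect -> R) : \sum_(P <- s) F P = \sum_(0 <= k < n) F (r k).
  by rewrite -(perm_big _ ps) /= (big_nth P0).
pose t := [seq r j | j <- iota 0 n & selected R w r j].
have lamd j k : (j <= k < n)%N -> lam (r k) <= lam (r j).
  move=> /andP[jk kn].
  have srt : sorted (fun P Q => lam Q <= lam P) s'.
    by apply: sort_sorted => P Q; rewrite orbC; exact: le_total.
  by apply: (sorted_leq_nth _ _ P0 srt) => //=;
    [move=> a b d ab bd; exact: le_trans bd ab|rewrite inE (leq_ltn_trans jk)].
exists t; split.
- rewrite map_inj_in_uniq ?filter_uniq ?iota_uniq// => j k.
  rewrite !mem_filter => /andP[sj _] /andP[sk _].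
  exact: (@selected_inj R w).
- by move=> P /mapP[j]; rewrite mem_filter mem_iota => /and3P[_ _ jn] ->; exact: rs.
- exact: sparse_selected.
pose V k := \big[setU/set0]_(j < k) rect w (r j).
have mV k : measurable (V k).
  by apply: bigsetU_measurable => i _; exact: measurable_rect.
(* The increments of [v] are the measures of the layers, those of [u] are supported on the selected
   indices, and [v <= u] is the weak type bound. Since [lam] decreases, [abel_le] passes from one to
   the other. *)
pose u k : R := 16 * \sum_(0 <= j < k | selected R w r j) area (r j).
pose v k : R := fine (mu2 (V k)).
have vE k : mu2 (V k) = (v k)%:E.
  rewrite /v fineK// ge0_fin_numE ?measure_ge0//.
  by apply: le_lt_trans (mu2_union_le R w r k) _; rewrite ltry.
have DE k : mu2 (seqDU (fun j => rect w (r j)) k) = (v k.+1 - v k)%:E.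
  have : ((v k.+1)%:E = (v k)%:E + mu2 (seqDU (fun j => rect w (r j)) k))%E.
    rewrite -!vE {1}/V big_ord_recr/= -/(V k) -measureU//; last 3 first.
    - exact: mV.
    - by apply: seqDU_measurable => j; exact: measurable_rect.
    - by rewrite /seqDU setDE setICA setICr setI0.
    congr (mu2 _); apply/seteqP; split => y [?|].
    + by left.
    + by move=> yk; have [?|?] := pselect (V k y); [left|right].
    + by left.
    + by move=> [yk _]; right.
  rewrite EFinB => ->; rewrite addeAC subee ?add0e//.
rewrite sumE.
rewrite -lee_fin.
apply: le_trans (@sum_le_layers w r n (lam \o r) (c \o r) H _ _ _ _ _ _) _ => //=.
- by move=> k /rs/lam0.
- by move=> k /rs/c0.
- by move=> y; rewrite -(sumE (fun P => c P * \1_(rect w P) y)); exact: cH.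
- by move=> k /rs/half.
under eq_bigr do rewrite DE -EFinM.
rewrite sumEFin lee_fin.
apply: (@le_trans _ _ (32 * \sum_(0 <= k < n) lam (r k) * (v k.+1 - v k))).
  by rewrite mulr_sumr; under [leRHS]eq_bigr do rewrite mulrA.
apply: (@le_trans _ _ (32 * \sum_(0 <= k < n) lam (r k) * (u k.+1 - u k))).
  rewrite ler_pM2l//; apply: abel_le => //.
  - by move=> k /rs/lam0.
  - by move=> k kn; apply: lamd; rewrite leqnSn.
  - by move=> k _; rewrite -lee_fin -vE; exact: mu2_union_le.
  - by rewrite /v /u /V big_ord0 measure0 big_geq ?mulr0.
rewrite big_map big_filter /index_iota subn0 mulr_sumr [leRHS]mulr_sumr.
rewrite [leRHS]big_mkcond/=; apply: ler_sum => k _.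
rewrite /u big_mkcond big_nat_recr//= -big_mkcond/=.
by case: ifP => _; lra.
Qed.
End Core.

(** * Truncated square functions *)

Lemma cauchy_schwarz_sum (R : rcfType) (I : Type) (s : seq I) (a b : I -> R) :
  \sum_(i <- s) a i * b i <=
  Num.sqrt (\sum_(i <- s) a i ^+ 2) * Num.sqrt (\sum_(i <- s) b i ^+ 2).
Proof.
elim: s => [|i s ih]; first by rewrite !big_nil sqrtr0 mulr0.
rewrite !big_cons.
set A := \sum_(j <- s) a j ^+ 2 in ih *; set B := \sum_(j <- s) b j ^+ 2 in ih *.
have A0 : 0 <= A by apply: sumr_ge0 => j _; exact: sqr_ge0.
have B0 : 0 <= B by apply: sumr_ge0 => j _; exact: sqr_ge0.
have [p0 q0] := (sqrtr_ge0 A, sqrtr_ge0 B).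
rewrite -sqrtrM ?addr_ge0 ?sqr_ge0//.
apply: (@le_trans _ _ `|a i * b i + Num.sqrt A * Num.sqrt B|).
  by apply: le_trans (ler_norm _); rewrite lerD2l.
rewrite -sqrtr_sqr; apply: ler_wsqrtr.
(* The two-term Cauchy-Schwarz inequality for [(a i, sqrt A)] and [(b i, sqrt B)]: the difference of
   the squares is this square. *)
have := sqr_ge0 (a i * Num.sqrt B - b i * Num.sqrt A).
move: (sqr_sqrtr A0) (sqr_sqrtr B0); move: (Num.sqrt A) (Num.sqrt B) => p q <- <-.
by rewrite -subr_ge0 => h; rewrite -subr_ge0; move: h; congr (0 <= _); ring.
Qed.

Lemma ge0_markov d (T : measurableType d) (R : realType)
    (mu : {measure set T -> \bar R}) (D : set T) (h : T -> R) (m : R) :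
  measurable D -> measurable_fun setT h -> (forall y, 0 <= h y) -> 0 < m ->
  (m%:E * mu (D `&` [set y | (m < h y)%R]) <= \int[mu]_(y in D) (h y)%:E)%E.
Proof.
move=> mD mh h0 m0.
have mB : measurable [set y | m < h y].
  rewrite (_ : [set y | m < h y] = h @^-1` `]m, +oo[%classic).
    by rewrite -[_ @^-1` _]setTI; apply: mh => //; exact: measurable_itv.
  by apply/seteqP; split => y /=; rewrite in_itv/= andbT.
rewrite setIC -integral_indic// -ge0_integralZl_EFin//; last 2 first.
- by apply/measurable_EFinP; exact: measurable_indic.
- exact: ltW.
apply: ge0_le_integral_nonmeasurable => y; rewrite -EFinM lee_fin.
  by rewrite mulr_ge0// ltW.
by rewrite indicE; case: (y \in _) / boolP => [/set_mem/= /ltW|_];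
  rewrite ?mulr1// mulr0.
Qed.

Section TruncatedSquareFunction.
Variable R : realType.
Local Notation mu2 := (@lebesgue_measure R \x @lebesgue_measure R)%E.
Local Notation rect := (@rect R).
Local Notation area := (@area R).
Variables (w : coins * coins) (s : seq drect).

(** It will be used with [x P] equal to the Haar mass times [sqrt (2 ^ (j.1 + j.2) / area P)]: the
    descendant containing a point of [P] contributes [2 ^ (j.1 + j.2) / area P] to the square
    function. *)
Definition trunc_square (x : drect -> R) (y : R * R) : R :=
  Num.sqrt (\sum_(P <- s) x P ^+ 2 * \1_(rect w P) y).

Lemma trunc_square_ge0 x y : 0 <= trunc_square x y.
Proof. exact: sqrtr_ge0. Qed.

Lemma measurable_trunc_square x : measurable_fun setT (trunc_square x).
Proof.
apply: (@measurableT_comp _ _ _ _ _ _ (@Num.sqrt R)).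
  apply: continuous_measurable_fun; exact: sqrt_continuous.
apply: measurable_sum => P; apply: measurable_funM => //.
by apply: measurable_indic; exact: measurable_rect.
Qed.

Lemma trunc_square_cauchy x z y :
  \sum_(P <- s) x P * z P * \1_(rect w P) y <= trunc_square x y * trunc_square z y.
Proof.
have e P : (\1_(rect w P) y : R) = \1_(rect w P) y * \1_(rect w P) y.
  by rewrite indicE; case: (_ \in _); rewrite ?mulr1 ?mulr0.
have E (u : drect -> R) : \sum_(P <- s) u P ^+ 2 * \1_(rect w P) y =
    \sum_(P <- s) (u P * \1_(rect w P) y) ^+ 2.
  by apply: eq_bigr => P _; rewrite exprMn; congr (_ * _); rewrite expr2; exact: e.
rewrite /trunc_square !E; apply: le_trans (cauchy_schwarz_sum _ _ _).
by apply: ler_sum => P _; rewrite mulrACA -e.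
Qed.

Lemma trunc_square_ge x P y : P \in s -> 0 <= x P -> rect w P y ->
  x P <= trunc_square x y.
Proof.
move=> sP xP yP; rewrite -[x P]ger0_norm// -sqrtr_sqr; apply: ler_wsqrtr.
rewrite (big_rem P)//= indicE mem_set// mulr1 lerDl sumr_ge0// => Q _.
by rewrite mulr_ge0 ?sqr_ge0.
Qed.

(** A bound uniform in [y], which makes the integrals over rectangles finite. *)
Lemma trunc_square_le x y : trunc_square x y <= Num.sqrt (\sum_(P <- s) x P ^+ 2).
Proof.
apply: ler_wsqrtr; apply: ler_sum => P _.
by rewrite ler_piMr ?sqr_ge0// indicE; case: (_ \in _).
Qed.

Definition trunc_mean (x : drect -> R) (P : drect) : R :=
  (area P)^-1 * fine (\int[mu2]_(y in rect w P) (trunc_square x y)%:E)%E.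

Lemma trunc_integralE x P :
  (\int[mu2]_(y in rect w P) (trunc_square x y)%:E = (trunc_mean x P * area P)%:E)%E.
Proof.
rewrite /trunc_mean mulrAC mulVf ?gt_eqF ?area_gt0// mul1r fineK//.
have y0 : (0 <= \int[mu2]_(y in rect w P) (trunc_square x y)%:E)%E.
  by apply: integral_ge0 => y _; rewrite lee_fin trunc_square_ge0.
rewrite ge0_fin_numE//; pose K := Num.sqrt (\sum_(P <- s) x P ^+ 2).
apply: (@le_lt_trans _ _ (\int[mu2]_(y in rect w P) (cst K%:E) y)%E).
  by apply: ge0_le_integral_nonmeasurable => y; rewrite lee_fin ?trunc_square_ge0 ?trunc_square_le.
rewrite integral_cst; last exact: measurable_rect.
by rewrite [X in (_ * X)%E]lebesgue_rect -EFinM ltry.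
Qed.

(** On [P] the function is at least [x P]. Positivity makes the mean usable as a threshold in
    Chebyshev's inequality. *)
Lemma trunc_mean_gt0 x P : P \in s -> 0 < x P -> 0 < trunc_mean x P.
Proof.
move=> sP xP.
have : ((x P * area P)%:E <= (trunc_mean x P * area P)%:E)%E.
  rewrite -trunc_integralE EFinM -(lebesgue_rect R w P) -integral_cst; last exact: measurable_rect.
  rewrite integral_mkcond [leRHS]integral_mkcond.
  apply: ge0_le_integral_nonmeasurable => y; rewrite /patch; case: ifPn => // yP; rewrite lee_fin.
  - exact: ltW.
  - by apply: trunc_square_ge => //; [exact: ltW|exact: set_mem].
by rewrite lee_fin ler_pM2r ?area_gt0// => /(lt_le_trans xP).
Qed.

Lemma trunc_square_small x P : P \in s -> 0 < x P ->
  (mu2 (rect w P `&` [set y | (4 * trunc_mean x P < trunc_square x y)%R])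
   <= (area P / 4)%:E)%E.
Proof.
move=> sP xP; have m0 := trunc_mean_gt0 sP xP.
have m40 : 0 < 4 * trunc_mean x P by rewrite mulr_gt0.
have := @ge0_markov _ _ _ mu2 (rect w P) (trunc_square x) _
  (measurable_rect w P) (measurable_trunc_square x) (trunc_square_ge0 x) m40.
rewrite trunc_integralE.
have -> : trunc_mean x P * area P = 4 * trunc_mean x P * (area P / 4) by field.
by rewrite [X in (_ <= X -> _)%E]EFinM lee_pmul2l// lte_fin.
Qed.

(** Each factor exceeds four times its mean on at most a quarter of [P]; on the remaining half the
    product is at most [4 * 4] times the product of the means. *)
Lemma trunc_good x z P : P \in s -> 0 < x P -> 0 < z P ->
  ((area P)%:E <= 2%:E * mu2 (rect w P `&`
    [set y | (trunc_square x y * trunc_square z y <=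
              16 * (trunc_mean x P * trunc_mean z P))%R]))%E.
Proof.
move=> sP xP zP.
set G := rect w P `&` _.
pose bad (x : drect -> R) := rect w P `&` [set y | (4 * trunc_mean x P < trunc_square x y)%R].
have mbad x' : measurable (bad x').
  apply: measurableI; first exact: measurable_rect.
  rewrite (_ : [set y | _] = trunc_square x' @^-1` `]4 * trunc_mean x' P, +oo[%classic).
    rewrite -[_ @^-1` _]setTI; apply: measurable_trunc_square => //; exact: measurable_itv.
  by apply/seteqP; split => y /=; rewrite in_itv/= andbT.
have mG : measurable G.
  apply: measurableI; first exact: measurable_rect.
  rewrite (_ : [set y | _] = (trunc_square x \* trunc_square z) @^-1`
     `]-oo, 16 * (trunc_mean x P * trunc_mean z P)]%classic).
    have mp : measurable_fun setT (trunc_square x \* trunc_square z).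
      by apply: measurable_funM; exact: measurable_trunc_square.
    by rewrite -[_ @^-1` _]setTI; apply: mp => //; exact: measurable_itv.
  by apply/seteqP; split => y /=; rewrite in_itv/=.
have mB : measurable (bad x `|` bad z) by exact: measurableU.
have : (mu2 (rect w P) <= mu2 G + ((area P / 4)%:E + (area P / 4)%:E))%E.
  apply: (@le_trans _ _ (mu2 (G `|` (bad x `|` bad z)))).
    apply: le_measure; rewrite ?inE; first exact: measurable_rect.
      exact: (measurableU _ _ mG mB).
    move=> y yP; have [h|h] := pselect (bad x y); first by right; left.
    have [h'|h'] := pselect (bad z y); first by right; right.
    left; split => //=.
    have hx : trunc_square x y <= 4 * trunc_mean x P.
      by rewrite leNgt; apply/negP => lt; apply: h.
    have hz : trunc_square z y <= 4 * trunc_mean z P.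
      by rewrite leNgt; apply/negP => lt; apply: h'.
    have := ler_pM (trunc_square_ge0 x y) (trunc_square_ge0 z y) hx hz.
    by move=> /le_trans; apply; lra.
  apply: le_trans (measureU2 _ _ _) _; [exact: mG|exact: mB|].
  apply: leeD => //; apply: le_trans (measureU2 _ _ _) _; [exact: mbad..|].
  by apply: leeD; exact: trunc_square_small.
rewrite lebesgue_rect; case: (mu2 G) => [g| |]; last 2 first.
- by move=> _; rewrite gt0_muley ?lte_fin// leey.
- by rewrite addNye leeNy_eq.
by rewrite -!EFinD -EFinM !lee_fin; lra.
Qed.

End TruncatedSquareFunction.

(** * Sparse domination of one shift *)

Lemma esum_ge1 (R : realType) (I : choiceType) (D : set I) (a : I -> \bar R) (k : I) :
  D k -> (a k <= \esum_(i in D) a i)%E.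
Proof.
move=> Dk; apply: esum_ge; exists [set k]; last by rewrite fsbig_set1.
by split=> [|_ ->]; first exact: finite_set1.
Qed.

Lemma subset_esum (R : realType) (I : choiceType) (D E : set I) (a : I -> \bar R) :
  D `<=` E -> (\esum_(i in D) a i <= \esum_(i in E) a i)%E.
Proof.
move=> DE; apply: le_ereal_sup => _ [X [fX XD] <-].
by exists X => //; split => //; exact: subset_trans DE.
Qed.

Section Domination.
Variable R : realType.
Local Notation mu2 := (@lebesgue_measure R \x @lebesgue_measure R)%E.
Local Notation rect := (@rect R).
Local Notation area := (@area R).
Implicit Types (w : coins * coins) (i j : nat * nat) (f g : R * R -> R).

(** Only the term of the descendant containing [y] is kept. *)
Lemma esum_tensor_ge w j P y : rect w P y ->
  ((2 ^+ (j.1 + j.2) / area P)%:E <= \esum_(Q in descendants2 R w P j)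
     (tensor (fun x => indic1 (@ditv R w.1 Q.1) x / @dlen R Q.1)
             (fun x => indic1 (@ditv R w.2 Q.2) x / @dlen R Q.2) y)%:E)%E.
Proof.
move=> [y1 y2].
have [Q1 dQ1 yQ1] := descendants_cover j.1 y1.
have [Q2 dQ2 yQ2] := descendants_cover j.2 y2.
apply: le_trans; last by apply: (@esum_ge1 _ _ _ _ (Q1, Q2)); split.
rewrite lee_fin /tensor /indic1 /= !indicE !mem_set// !mul1r.
have -> : @dlen R Q1 = @dlen R P.1 / 2 ^+ j.1.
  by case: (Q1) dQ1 => m n [/= -> _]; case: (P.1) => m' n'; exact: dlen_add.
have -> : @dlen R Q2 = @dlen R P.2 / 2 ^+ j.2.
  by case: (Q2) dQ2 => m n [/= -> _]; case: (P.2) => m' n'; exact: dlen_add.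
by rewrite !invf_div mulf_div exprD.
Qed.

(** [fine] sends infinity to 0, so this is used only for rectangles of finite Haar mass. *)
Definition mass w i f P : R := fine (haar_mass w i f P).

Lemma haar_mass_ge0 w i f P : (0 <= haar_mass w i f P)%E.
Proof. by apply: esum_ge0 => Q _; rewrite lee_fin. Qed.

Lemma square_fun_ge w i j f (s : seq drect) y : uniq s ->
  (forall P, P \in s -> haar_mass w i f P \is a fin_num) ->
  ((trunc_square w s (fun P => mass w i f P * Num.sqrt (2 ^+ (j.1 + j.2) / area P)) y)%:E
   <= square_fun w i j f y)%E.
Proof.
move=> us fs; rewrite /square_fun.
set X := (\esum_(P in _) _)%E.
have t0 w' Q z : (0 <= (tensor (fun x => indic1 (@ditv R w'.1 Q.1) x / @dlen R Q.1)
             (fun x => indic1 (@ditv R w'.2 Q.2) x / @dlen R Q.2) z)%:E)%E.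
  by rewrite lee_fin mulr_ge0// divr_ge0// ltW// dlen_gt0.
have X0 : (0 <= X)%E.
  apply: esum_ge0 => P _; apply: mule_ge0; first exact/expe_ge0/haar_mass_ge0.
  by apply: esum_ge0 => Q _; exact: t0.
rewrite -[leLHS]/(sqrte (EFin _)) lee_sqrt//.
apply: esum_ge; exists [set` s]; first by split => //; exact: finite_seq.
rewrite -fsbig_seq// -sumEFin !big_seq; apply: lee_sum => P sP.
have Pnn : (0 <= 2 ^+ (j.1 + j.2) / area P).
  by rewrite divr_ge0 ?exprn_ge0// ltW// area_gt0.
rewrite exprMn sqr_sqrtr//.
rewrite -(fineK (fs P sP)) -/(mass w i f P) -EFin_expe.
rewrite indicE; case: (y \in _) / boolP => [/set_mem yP|_]; last first.
  rewrite mulr0; apply: mule_ge0; first by rewrite lee_fin sqr_ge0.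
  by apply: esum_ge0 => Q _; exact: t0.
rewrite mulr1 EFinM; apply: lee_wpmul2l; first by rewrite lee_fin sqr_ge0.
exact: esum_tensor_ge.
Qed.

Lemma mean_square_fun_ge w i j f (s : seq drect) P : uniq s ->
  (forall P, P \in s -> haar_mass w i f P \is a fin_num) ->
  ((trunc_mean w s (fun P => mass w i f P * Num.sqrt (2 ^+ (j.1 + j.2) / area P)) P)%:E
   <= mean (square_fun w i j f) (rect w P))%E.
Proof.
move=> us fs; rewrite /mean lebesgue_rect /=.
set x := fun P => _.
have -> : trunc_mean w s x P = (area P)^-1 * (trunc_mean w s x P * area P).
  by rewrite mulrCA mulVf ?mulr1// gt_eqF// area_gt0.
rewrite EFinM -trunc_integralE; apply: lee_wpmul2l.
  by rewrite lee_fin invr_ge0 ltW// area_gt0.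
apply: ge0_le_integral_nonmeasurable => y; first by rewrite lee_fin trunc_square_ge0.
exact: square_fun_ge.
Qed.

Lemma sparse_form_ge0 w i j f g L : (0 <= sparse_form w i j f g L)%E.
Proof.
apply: esum_ge0 => A _.
have m0 i' j' h : (0 <= mean (square_fun w i' j' h) A)%E.
  rewrite mule_ge0 ?lee_fin ?invr_ge0 ?fine_ge0//.
  by apply: integral_ge0 => y _; exact: sqrte_ge0.
apply: mule_ge0; last exact: m0.
by apply: mule_ge0; last exact: m0.
Qed.

Lemma sparse_form_ge w i j f g (t : seq drect) (a b : drect -> R) : uniq t ->
  (forall P, P \in t -> 0 <= a P /\ ((a P)%:E <= mean (square_fun w i j f) (rect w P))%E) ->
  (forall P, P \in t -> 0 <= b P /\ ((b P)%:E <= mean (square_fun w j i g) (rect w P))%E) ->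
  ((\sum_(P <- t) a P * b P * area P)%:E <=
   sparse_form w i j f g [set rect w P | P in [set` t]])%E.
Proof.
move=> ut ha hb; rewrite /sparse_form (reindex_esum [set` t] _ (rect w)); last first.
  split; [by move=> P tP; exists P|by move=> P Q _ _; exact: rect_inj|].
  by move=> _ [P tP <-]; exists P.
apply: esum_ge; exists [set` t]; first by split => //; exact: finite_seq.
rewrite -fsbig_seq// -sumEFin !big_seq; apply: lee_sum => P tP.
have [a0 aP] := ha P tP; have [b0 bP] := hb P tP; rewrite -lee_fin in a0; rewrite -lee_fin in b0.
have -> : a P * b P * area P = area P * a P * b P by ring.
rewrite lebesgue_rect (EFinM (area P * a P)) (EFinM (area P) (a P)).
have r0 : (0 <= (area P)%:E)%E by rewrite lee_fin ltW// area_gt0.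
apply: (lee_pmul (mule_ge0 r0 a0) b0 _ bP).
exact: (lee_wpmul2l r0 aP).
Qed.

Lemma finite_domination w i j f g (s : seq drect) : uniq s ->
  (forall P, P \in s -> (0 < haar_mass w i f P < +oo)%E) ->
  (forall P, P \in s -> (0 < haar_mass w j g P < +oo)%E) ->
  exists L, [/\ L `<=` grid2 w, sparse (4^-1 : R) L &
    ((\sum_(P <- s) mass w i f P * mass w j g P *
        Num.sqrt (2 ^+ (i.1 + i.2 + j.1 + j.2)))%:E
     <= 512%:E * sparse_form w i j f g L)%E].
Proof.
move=> us fs gs.
(* With this normalisation [x P * z P * area P] is exactly the summand of the statement: the areas
   under the two roots cancel the factor [area P]. *)
pose x P := mass w i f P * Num.sqrt (2 ^+ (j.1 + j.2) / area P).
pose z P := mass w j g P * Num.sqrt (2 ^+ (i.1 + i.2) / area P).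
have ffs P : P \in s -> haar_mass w i f P \is a fin_num.
  by move=> /fs/andP[f0 foo]; rewrite ge0_fin_numE// ltW.
have gfs P : P \in s -> haar_mass w j g P \is a fin_num.
  by move=> /gs/andP[g0 goo]; rewrite ge0_fin_numE// ltW.
have sq0 (n : nat) P : 0 < Num.sqrt (2 ^+ n / area P).
  by rewrite sqrtr_gt0 divr_gt0 ?exprn_gt0 ?area_gt0.
have x0 P : P \in s -> 0 < x P.
  move=> sP; rewrite mulr_gt0// -lte_fin fineK ?ffs//.
  by have /andP[] := fs _ sP.
have z0 P : P \in s -> 0 < z P.
  move=> sP; rewrite mulr_gt0// -lte_fin fineK ?gfs//.
  by have /andP[] := gs _ sP.
have [|||||t [ut ts st le]] := @sparse_selection R w s
  (fun P => trunc_mean w s x P * trunc_mean w s z P) (fun P => x P * z P)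
  (trunc_square w s x \* trunc_square w s z).
- by move=> P sP; rewrite mulr_ge0// ltW// trunc_mean_gt0 ?x0 ?z0.
- by move=> P sP; rewrite mulr_ge0// ltW ?x0 ?z0.
- by apply: measurable_funM; exact: measurable_trunc_square.
- by move=> y; exact: trunc_square_cauchy.
- by move=> P sP; apply: trunc_good; rewrite ?x0 ?z0.
exists [set rect w P | P in [set` t]]; split => //.
  by move=> _ [P _ <-]; exists P.
have -> : \sum_(P <- s) mass w i f P * mass w j g P *
        Num.sqrt (2 ^+ (i.1 + i.2 + j.1 + j.2)) =
    \sum_(P <- s) x P * z P * area P.
  apply: eq_bigr => P _; have a0 := area_gt0 R P.
  have -> : Num.sqrt (2 ^+ (i.1 + i.2 + j.1 + j.2)) =
      Num.sqrt (2 ^+ (j.1 + j.2) / area P) * Num.sqrt (2 ^+ (i.1 + i.2) / area P) * area P.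
    rewrite !sqrtrM ?exprn_ge0// [X in X * area P]mulrACA -expr2 sqr_sqrtr ?invr_ge0 ?ltW//.
    rewrite divfK ?gt_eqF// -sqrtrM ?exprn_ge0// -exprD.
    by congr (Num.sqrt (_ ^+ _)); lia.
  by rewrite /x /z; ring.
rewrite -lee_fin in le; apply: le_trans le _.
rewrite (EFinM 512).
have k0 : (0 <= 512%:E :> \bar R)%E by rewrite lee_fin; exact: ler0n.
apply: (lee_wpmul2l k0).
apply: sparse_form_ge => // P /ts sP; split.
- by apply/ltW/trunc_mean_gt0 => //; exact: x0.
- exact: mean_square_fun_ge.
- by apply/ltW/trunc_mean_gt0 => //; exact: z0.
- exact: mean_square_fun_ge.
Qed.

Lemma domination w i j f g :
  (\esum_(P in setT) (haar_mass w i f P * haar_mass w j g P) < +oo)%E ->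
  exists L, [/\ L `<=` grid2 w, sparse (4^-1 : R) L &
    ((Num.sqrt (2 ^+ (i.1 + i.2 + j.1 + j.2)))%:E *
       (\esum_(P in setT) (haar_mass w i f P * haar_mass w j g P))
     <= 1024%:E * sparse_form w i j f g L)%E].
Proof.
set u := fun P => (haar_mass w i f P * haar_mass w j g P)%E.
set T := (\esum_(P in _) _)%E => Too.
have u0 P : (0 <= u P)%E by rewrite mule_ge0 ?haar_mass_ge0.
have T0 : (0 <= T)%E by apply: esum_ge0 => P _; exact: u0.
have sf0 := sparse_form_ge0 w i j f g.
(* A zero total is separate, because no finite partial sum exceeds half of it strictly. *)
have [T00|Tn0] := eqVneq T 0%E.
  exists set0; split; [by []|by exists (fun A => A); split|].
  rewrite T00 mule0; apply: mule_ge0; last exact: sf0.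
  by rewrite lee_fin; exact: ler0n.
have TE : T = (fine T)%:E by rewrite fineK// ge0_fin_numE.
have fT0 : 0 < fine T by rewrite -lte_fin -TE lt_def Tn0.
have : ((fine T / 2)%:E < T)%E by rewrite [ltRHS]TE lte_fin; lra.
move=> /ereal_sup_gt[_ [X [fX _] <-]] ltX.
have [s0 [us0 sX]] : exists s0 : seq drect, uniq s0 /\ X = [set` s0].
  have /finite_seqP[s1 ->] := fX; exists (undup s1); split; first exact: undup_uniq.
  by apply/seteqP; split => P /=; rewrite mem_undup.
(* Dropping vanishing products does not change the sum, and makes both masses positive; they are
   then finite because their product is. *)
pose s := [seq P <- s0 | (0 < u P)%E].
have uoo P : (u P < +oo)%E by apply: le_lt_trans Too; exact: esum_ge1.
have pos P : P \in s -> (0 < haar_mass w i f P < +oo)%E /\ (0 < haar_mass w j g P < +oo)%E.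
  rewrite mem_filter => /andP[up _]; have := uoo P; move: up; rewrite /u.
  move: (haar_mass_ge0 w i f P) (haar_mass_ge0 w j g P).
  case: (haar_mass w i f P) => [a| |]//; case: (haar_mass w j g P) => [b| |]//;
    rewrite ?lee_fin => a0 b0.
  - move=> + _; rewrite -EFinM !lte_fin !ltry !andbT => ab.
    split; rewrite lt_def ?a0 ?b0 andbT; apply: contraTneq ab => ->;
      by rewrite ?mul0r ?mulr0 ltxx.
  - have [->|an0] := eqVneq a 0; first by rewrite mul0e ltxx.
    by rewrite gt0_muley ?lte_fin ?lt_def ?an0.
  - have [->|bn0] := eqVneq b 0; first by rewrite mule0 ltxx.
    by rewrite gt0_mulye ?lte_fin ?lt_def ?bn0.
have [||L [Lg Ls le]] := @finite_domination w i j f g s (filter_uniq _ us0).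
- by move=> P /pos[].
- by move=> P /pos[].
exists L; split => //.
have -> : (1024%:E = 2%:E * 512%:E :> \bar R)%E by rewrite -EFinM -natrM.
have k0 : (0 <= 2%:E :> \bar R)%E by rewrite lee_fin; exact: ler0n.
rewrite -muleA; apply: le_trans (lee_wpmul2l k0 le).
have uE P : P \in s -> u P = (mass w i f P * mass w j g P)%:E.
  move=> /pos[/andP[f0 foo] /andP[g0 goo]].
  by rewrite EFinM !fineK ?ge0_fin_numE// ltW.
have XE : (\sum_(P \in X) u P = (\sum_(P <- s) mass w i f P * mass w j g P)%:E)%E.
  rewrite sX -fsbig_seq// -sumEFin (bigID (fun P => 0 < u P)%E)/=.
  rewrite [X in (_ + X)%E]big1 ?adde0; last first.
    by move=> P; rewrite -leNgt => uP; apply/eqP; rewrite eq_le uP u0.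
  by rewrite -big_filter !big_seq; apply: eq_bigr => P /uE.
rewrite [X in (_ < X)%E]XE lte_fin in ltX.
rewrite -mulr_suml TE -!EFinM lee_fin.
set q := Num.sqrt _; have q0 : 0 <= q by exact: sqrtr_ge0.
by rewrite mulrA [leRHS]mulrC ler_wpM2l//; lra.
Qed.

End Domination.

(** * Haar coefficients over descendants and the pairing of one shift *)

Section Shifts.
Variable R : realType.
Implicit Types (w : coins * coins) (i j : nat * nat) (f g : R * R -> R).

(** The residues of the two indices modulo [2 ^ i.1] and [2 ^ i.2] determine a descendant of [P]. *)
Lemma size_descendants2 w i P (r : seq drect) : uniq r ->
  (forall Q, Q \in r -> descendants2 R w P i Q) -> (size r <= 2 ^ i.1 * 2 ^ i.2)%N.
Proof.
move=> ur rP.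
pose residue (k : nat) (J : dyad) : nat := `|(J.2 %% (2 ^+ k))%Z|%N.
have k0 (k : nat) : 0 < 2 ^+ k :> int by rewrite exprn_gt0.
have resE k J : (residue k J)%:Z = (J.2 %% (2 ^+ k))%Z.
  by rewrite /residue gez0_abs// modz_ge0// gt_eqF.
have residue_lt k J : (residue k J < 2 ^ k)%N.
  by rewrite -ltz_nat resE -[X in _ < X]natz natrX ltz_pmod.
have residue_inj eta I k J J' : descendants R eta I k J -> descendants R eta I k J' ->
    residue k J = residue k J' -> J = J'.
  move=> dJ dJ' e; apply: (descendants_residue dJ dJ').
  by apply/eqP; rewrite -[LHS]resE -[RHS]resE e.
pose h Q := (residue i.1 Q.1, residue i.2 Q.2).
rewrite -(size_map h).
have -> : (2 ^ i.1 * 2 ^ i.2)%N =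
    size (allpairs pair (iota 0 (2 ^ i.1)) (iota 0 (2 ^ i.2))).
  by rewrite size_allpairs !size_iota.
apply: uniq_leq_size.
  rewrite map_inj_in_uniq// => -[Q1 Q2] [Q1' Q2'] /rP[d1 d2] /rP[d1' d2'] [e1 e2].
  by congr pair; [exact: residue_inj d1 d1' e1|exact: residue_inj d2 d2' e2].
by move=> _ /mapP[Q _ ->]; apply: allpairs_f; rewrite mem_iota /= residue_lt.
Qed.

Lemma descendants2_uniq w i P P' Q :
  descendants2 R w P i Q -> descendants2 R w P' i Q -> P = P'.
Proof.
case: P P' => [I J] [I' J'] [/= h1 h2] [/= h1' h2'].
by rewrite (descendants_uniq h1 h1') (descendants_uniq h2 h2').
Qed.

Definition coef_energy w i f P : \bar R :=
  (\esum_(Q in descendants2 R w P i) (haar_coef w f Q ^+ 2)%:E)%E.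

(** Cauchy-Schwarz against the constant 1, with at most [2 ^ i.1 * 2 ^ i.2] terms. *)
Lemma haar_mass_le w i f P M : (coef_energy w i f P <= M%:E)%E ->
  (haar_mass w i f P <= (Num.sqrt ((2 ^ i.1 * 2 ^ i.2)%:R * M))%:E)%E.
Proof.
move=> hM; apply: ge_ereal_sup => _ [X [fX XD] <-].
have /finite_seqP[s0 XE] := fX; pose s := undup s0.
have sX : X = [set` s] by rewrite XE; apply/seteqP; split => Q /=; rewrite mem_undup.
have us : uniq s by exact: undup_uniq.
rewrite sX -fsbig_seq// sumEFin lee_fin.
have -> : \sum_(Q <- s) `|haar_coef w f Q| = \sum_(Q <- s) 1 * `|haar_coef w f Q|.
  by apply: eq_bigr => Q _; rewrite mul1r.
apply: le_trans (cauchy_schwarz_sum _ _ _) _.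
have E0 : 0 <= \sum_(Q <- s) `|haar_coef w f Q| ^+ 2.
  by apply: sumr_ge0 => Q _; exact: sqr_ge0.
rewrite -sqrtrM; last by apply: sumr_ge0 => Q _; exact: sqr_ge0.
apply: ler_wsqrtr; apply: ler_pM => //.
- by apply: sumr_ge0 => Q _; exact: sqr_ge0.
- rewrite (eq_bigr (fun=> 1)); last by move=> Q _; rewrite expr1n.
  rewrite big_const_seq count_predT iter_addr_0 ler_nat.
  by apply: (size_descendants2 us) => Q sQ; apply: XD; rewrite sX.
- rewrite -lee_fin; apply: le_trans hM; apply: esum_ge; exists X => //.
  rewrite sX -fsbig_seq// -sumEFin.
  by rewrite (eq_bigr (fun Q => (haar_coef w f Q ^+ 2)%:E))// => Q _; rewrite real_normK ?num_real.
Qed.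

(** A rectangle is a descendant of order [i] of at most one [P], so no coefficient is counted
    twice. *)
Lemma esum_coef_energy w i f :
  (\esum_(P in setT) coef_energy w i f P <= \esum_(P in setT) (haar_coef w f P ^+ 2)%:E)%E.
Proof.
rewrite /coef_energy esum_esum; last by move=> P Q _ _; rewrite lee_fin sqr_ge0.
set D := setT `*`` _.
have bij : set_bij D (snd @` D) snd.
  split.
  - by move=> k Dk; exists k.
  - move=> [P Q] [P' Q'] /set_mem[_ /= d] /set_mem[_ /= d'] /= e.
    by rewrite -e in d' *; rewrite (descendants2_uniq d d').
  - by move=> _ [k Dk <-]; exists k.
rewrite -(reindex_esum _ _ snd (fun Q => (haar_coef w f Q ^+ 2)%:E) bij).
exact: subset_esum.
Qed.

(** The product of two masses is at most the sum of their squares, and each square is controlled by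
    the energy of the descendants. *)
Lemma esum_mass_lty w i j f g :
  (\esum_(P in setT) (haar_coef w f P ^+ 2)%:E < +oo)%E ->
  (\esum_(P in setT) (haar_coef w g P ^+ 2)%:E < +oo)%E ->
  (\esum_(P in setT) (haar_mass w i f P * haar_mass w j g P) < +oo)%E.
Proof.
move=> foo goo.
have e0 k h P : (0 <= coef_energy w k h P)%E.
  by apply: esum_ge0 => Q _; rewrite lee_fin sqr_ge0.
have eoo k h : (\esum_(P in setT) (haar_coef w h P ^+ 2)%:E < +oo)%E ->
    (\esum_(P in setT) coef_energy w k h P < +oo)%E.
  by apply: le_lt_trans; exact: esum_coef_energy.
have eE k h P : (\esum_(P in setT) (haar_coef w h P ^+ 2)%:E < +oo)%E ->
    coef_energy w k h P = (fine (coef_energy w k h P))%:E.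
  move=> hoo; rewrite fineK// ge0_fin_numE//.
  by apply: le_lt_trans (eoo k h hoo); exact: esum_ge1.
pose N (k : nat * nat) : R := (2 ^ k.1 * 2 ^ k.2)%:R.
have N0 k : (0 <= (N k)%:E)%E by rewrite lee_fin ler0n.
apply: (@le_lt_trans _ _ (\esum_(P in setT)
   ((N i)%:E * coef_energy w i f P + (N j)%:E * coef_energy w j g P))%E).
  apply: le_esum => P _.
  have /haar_mass_le hf : (coef_energy w i f P <= (fine (coef_energy w i f P))%:E)%E.
    by rewrite -eE.
  have /haar_mass_le hg : (coef_energy w j g P <= (fine (coef_energy w j g P))%:E)%E.
    by rewrite -eE.
  apply: le_trans (lee_pmul (haar_mass_ge0 w i f P) (haar_mass_ge0 w j g P) hf hg) _.
  rewrite [in leRHS](eE i f P foo) [in leRHS](eE j g P goo) -!EFinM -EFinD lee_fin.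
  rewrite -/(N i) -/(N j).
  have a0 : 0 <= N i * fine (coef_energy w i f P) by rewrite mulr_ge0 ?fine_ge0.
  have b0 : 0 <= N j * fine (coef_energy w j g P) by rewrite mulr_ge0 ?fine_ge0.
  rewrite -[leRHS](congr2 +%R (sqr_sqrtr a0) (sqr_sqrtr b0)).
  by set p := Num.sqrt _; set q := Num.sqrt _; have := sqr_ge0 (p - q);
     have := sqr_ge0 p; have := sqr_ge0 q; nra.
rewrite esumD; last 2 first.
- by move=> P _; exact: mule_ge0.
- by move=> P _; exact: mule_ge0.
apply: lte_add_pinfty; apply: le_lt_trans (ge0_esumZl_le _ (N0 _) (e0 _ _)) _.
  by rewrite lte_mul_pinfty// eoo.
by rewrite lte_mul_pinfty// eoo.
Qed.

(** After the triangle inequality the triples are grouped by their ancestor [S]; the sums over [P]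
    and [Q] then separate into the two Haar masses of [S]. *)
Lemma shift_pairing_le w i j a f g : shift_coefs w i j a ->
  (`|shift_pairing w i j a f g| <= (2 `^ (- (i.1 + j.1 + i.2 + j.2)%N%:R / 2))%:E *
     (\esum_(P in setT) (haar_mass w i f P * haar_mass w j g P)))%E.
Proof.
set k := 2 `^ _ => ha.
have k0 : (0 <= k%:E)%E by rewrite lee_fin powR_ge0.
apply: le_trans (abse_ssum_le _ _) _.
have m0 P : (0 <= haar_mass w i f P * haar_mass w j g P)%E.
  by apply: mule_ge0; exact: haar_mass_ge0.
apply: le_trans; last exact: (ge0_esumZl_le _ k0 m0).
pose D := [set: drect] `*`` (fun S => descendants2 R w S i `*` descendants2 R w S j).
pose e (t : drect * (drect * drect)) := (t.2.1, t.2.2, t.1).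
have bij : set_bij D (shift_triples R w i j) e.
  split.
  - by move=> [S [P Q]] [_ []].
  - by move=> [S [P Q]] [S' [P' Q']] _ _ [-> -> ->].
  - by move=> [[P Q] S] [hP hQ]; exists (S, (P, Q)).
rewrite (reindex_esum D _ e)//.
pose F (P Q : drect) : \bar R := (k%:E * (`|haar_coef w f P|%:E * `|haar_coef w g Q|%:E))%E.
have F0 P Q : (0 <= F P Q)%E.
  by apply: mule_ge0 => //; apply: mule_ge0; rewrite lee_fin.
apply: (@le_trans _ _ (\esum_(t in D) F t.2.1 t.2.2)%E).
  apply: le_esum => -[S [P Q]] [_ [hP hQ]] /=.
  rewrite /F -!EFinM lee_fin !normrM -mulrA ler_wpM2r ?mulr_ge0//.
  exact: ha.
rewrite -(@esum_esum _ _ _ setT _ (fun _ PQ => F PQ.1 PQ.2))//.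
apply: le_esum => S _.
rewrite -[descendants2 R w S i `*` _]/(descendants2 R w S i `*`` (fun=> descendants2 R w S j)).
rewrite -(@esum_esum _ _ _ _ (fun=> descendants2 R w S j) F)//.
apply: (@le_trans _ _ (\esum_(P in descendants2 R w S i)
    (k%:E * (haar_mass w j g S * `|haar_coef w f P|%:E)))%E).
  apply: le_esum => P _.
  apply: (le_trans (ge0_esumZl_le _ k0 _)).
    by move=> Q; apply: mule_ge0; rewrite lee_fin.
  apply: (lee_wpmul2l k0); rewrite [leRHS]muleC.
  by apply: ge0_esumZl_le => [|Q]; rewrite lee_fin.
apply: (le_trans (ge0_esumZl_le _ k0 _)).
  by move=> P; apply: mule_ge0; rewrite ?lee_fin//; exact: haar_mass_ge0.
apply: (lee_wpmul2l k0); rewrite [leRHS]muleC.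
by apply: ge0_esumZl_le => [|P]; rewrite ?lee_fin//; exact: haar_mass_ge0.
Qed.

(** One family serves all shifts of the given complexity. The coefficient bound is
    [2^(-n/2) = tau * 2^(n/2)], where [n] is the sum of the four indices, and [domination] absorbs
    [2^(n/2)]. *)
Lemma shift_domination w i j f g :
  (\esum_(P in setT) (haar_coef w f P ^+ 2)%:E < +oo)%E ->
  (\esum_(P in setT) (haar_coef w g P ^+ 2)%:E < +oo)%E ->
  exists L, [/\ L `<=` grid2 w, sparse (4^-1 : R) L &
    forall a, shift_coefs w i j a ->
    (`|shift_pairing w i j a f g| <=
     1024%:E * ((tau R i j)%:E * sparse_form w i j f g L))%E].
Proof.
move=> foo goo; have [L [Lg Ls le]] := domination (esum_mass_lty i j foo goo).
exists L; split => // a ha; apply: le_trans (shift_pairing_le _ _ ha) _.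
set n := (i.1 + i.2 + j.1 + j.2)%N in le.
have -> : 2 `^ (- (i.1 + j.1 + i.2 + j.2)%N%:R / 2) = (tau R i j * Num.sqrt (2 ^+ n) : R).
  have -> : (i.1 + j.1 + i.2 + j.2 = n)%N by rewrite /n; lia.
  rewrite mulNr powRN powRrM powR_mulrn// powR12_sqrt ?exprn_ge0//.
  rewrite /tau -/n exprVn -{2}(@sqr_sqrtr _ (2 ^+ n)) ?exprn_ge0//.
  by rewrite expr2 invfM divfK// gt_eqF// sqrtr_gt0 exprn_gt0.
have t0 : (0 <= (tau R i j)%:E)%E by rewrite lee_fin exprn_ge0// invr_ge0 ler0n.
by rewrite EFinM -muleA [leRHS]muleCA; exact: (lee_wpmul2l t0 le).
Qed.

End Shifts.

(** * Bessel's inequality *)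

Section LinearCombinations.
Context d (T : measurableType d) (R : realType) (mu : {measure set T -> \bar R}).
Local Notation intg h := (mu.-integrable setT (EFin \o h)).

Lemma Rintegral_lincomb (I : eqType) (s : seq I) (c : I -> R) (F : I -> T -> R) :
  (forall i, i \in s -> intg (F i)) ->
  intg (fun x => \sum_(i <- s) c i * F i x) /\
  Rintegral mu setT (fun x => \sum_(i <- s) c i * F i x) =
  \sum_(i <- s) c i * Rintegral mu setT (F i).
Proof.
elim: s => [|i s ih] h.
  have -> : (fun x => \sum_(i <- [::]) c i * F i x) = cst 0.
    by apply/funext => x; rewrite big_nil.
  rewrite big_nil; split; first exact: integrable0.
  by rewrite Rintegral_cst// mul0r.
have [k ks|ih1 ih2] := ih; first by apply: h; rewrite inE ks orbT.
have hi : intg (F i) by apply: h; rewrite inE eqxx.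
have hci : intg (fun x => c i * F i x) by exact: (integrableZl measurableT (c i) hi).
have -> : (fun x => \sum_(k <- i :: s) c k * F k x) =
    (fun x => c i * F i x + \sum_(k <- s) c k * F k x).
  by apply/funext => x; rewrite big_cons.
split; first exact: (integrableD measurableT hci ih1).
by rewrite RintegralD// RintegralZl// ih2 big_cons.
Qed.

Lemma Rintegral_indic (A : set T) : measurable A ->
  Rintegral mu setT \1_A = fine (mu A).
Proof. by move=> mA; rewrite /Rintegral integral_indic// setIT. Qed.

Lemma integrable_indic_fin (A : set T) : measurable A -> (mu A < +oo)%E -> intg \1_A.
Proof.
move=> mA Aoo; apply/integrableP; split.
  by apply/measurable_EFinP; exact: measurable_indic.
under eq_integral do rewrite /= ger0_norm//.
by rewrite integral_indic// setIT.
Qed.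

End LinearCombinations.

Section Haar.
Variable R : realType.
Local Notation mu := (@lebesgue_measure R).
Local Notation dlen := (@dlen R).
Local Notation ditv := (@ditv R).
Local Notation haar := (@haar R).

Lemma haarE eta I x : haar eta I x = (Num.sqrt (dlen I))^-1 *
  (\1_(ditv eta (dyad_half eta I false)) x - \1_(ditv eta (dyad_half eta I true)) x).
Proof. by rewrite /Defs.haar ditv_left_half ditv_right_half. Qed.

Lemma half_disjoint eta I x :
  ditv eta (dyad_half eta I false) x -> ~ ditv eta (dyad_half eta I true) x.
Proof.
by rewrite ditv_left_half ditv_right_half /= !in_itv /= => /andP[_ +] /andP[+ _]; lra.
Qed.

Lemma haar_out eta I x : ~ ditv eta I x -> haar eta I x = 0.
Proof.
move=> nx; rewrite haarE !indicE !memNset ?subrr ?mulr0// => /ditv_half_sub; exact.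
Qed.

(** Either [J] misses [I], or it lies in one half of [I], where the Haar function of [I] is
    constant. *)
Lemma haar_mul eta I J : I.1 <= J.1 -> I != J ->
  exists c, forall x, haar eta I x * haar eta J x = c * haar eta J x.
Proof.
move=> IJ nIJ.
have [Jx|nJ] := pselect (exists b x, ditv eta (dyad_half eta I b) x /\ ditv eta J x); last first.
  exists 0 => x; rewrite mul0r; have [xJ|xJ] := pselect (ditv eta J x); last first.
    by rewrite (haar_out xJ) mulr0.
  rewrite haarE !indicE !memNset ?subrr ?mulr0 ?mul0r// => xI; apply: nJ;
    by do 2! eexists; split; eassumption.
have [b [y [yI yJ]]] := Jx.
have lt : (dyad_half eta I b).1 <= J.1.
  rewrite /dyad_half /= lezD1 lt_neqAle IJ andbT; apply/eqP => e.
  move: nIJ yI yJ; case: I J IJ e {Jx} => [m n] [m' n'] /= _ <- nIJ /ditv_half_sub yI yJ.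
  by rewrite (ditv_same_level yI yJ) eqxx in nIJ.
have sub : ditv eta J `<=` ditv eta (dyad_half eta I b).
  by apply: ditv_nested => //; exists y.
exists ((Num.sqrt (dlen I))^-1 * (if b then -1 else 1)) => x.
have [xJ|xJ] := pselect (ditv eta J x); last by rewrite (haar_out xJ) !mulr0.
congr (_ * _); rewrite haarE; congr (_ * _); rewrite !indicE.
have := sub _ xJ; case: b {yI sub lt} => xb.
  by rewrite (mem_set xb) memNset ?sub0r// => /half_disjoint.
by rewrite (mem_set xb) memNset ?subr0//; exact: half_disjoint.
Qed.

Lemma lebesgue_half eta I b :
  mu (ditv eta (dyad_half eta I b)) = (dlen I / 2)%:E.
Proof. by rewrite lebesgue_ditv /dyad_half; case: I => m n; rewrite (dlen_succ R m _ n). Qed.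

Lemma integrable_half eta I b :
  mu.-integrable setT (EFin \o \1_(ditv eta (dyad_half eta I b))).
Proof.
apply: integrable_indic_fin; first exact: measurable_ditv.
by rewrite [ltLHS]lebesgue_half ltry.
Qed.

Lemma Rintegral_haar_lincomb eta I (c : bool -> R) :
  mu.-integrable setT (EFin \o (fun x => \sum_(b <- [:: false; true]) c b * \1_(ditv eta (dyad_half eta I b)) x)) /\
  Rintegral mu setT (fun x => \sum_(b <- [:: false; true]) c b * \1_(ditv eta (dyad_half eta I b)) x)
  = (c false + c true) * (dlen I / 2).
Proof.
have [h1 h2] := @Rintegral_lincomb _ _ _ mu _ [:: false; true] c
  (fun b => \1_(ditv eta (dyad_half eta I b))) (fun b _ => integrable_half eta I b).
split => //; rewrite h2 big_cons big_seq1.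
rewrite !Rintegral_indic; try exact: measurable_ditv.
rewrite [X in c false * fine X]lebesgue_half [X in c true * fine X]lebesgue_half.
by rewrite /= mulrDl.
Qed.

Lemma haar_lincomb eta I : haar eta I = (fun x =>
  \sum_(b <- [:: false; true])
    ((Num.sqrt (dlen I))^-1 * (-1) ^+ b) * \1_(ditv eta (dyad_half eta I b)) x).
Proof.
apply/funext => x.
by rewrite haarE big_cons big_seq1 expr0 expr1 mulr1 mulrN1 mulNr mulrBr.
Qed.

Lemma Rintegral_haar eta I : Rintegral mu setT (haar eta I) = 0.
Proof.
rewrite haar_lincomb.
rewrite (Rintegral_haar_lincomb eta I (fun b => (Num.sqrt (dlen I))^-1 * (-1) ^+ b)).2.
by rewrite expr0 expr1 mulr1 mulrN1 subrr mul0r.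
Qed.

Lemma integrable_haar eta I : mu.-integrable setT (EFin \o haar eta I).
Proof.
rewrite haar_lincomb.
exact: (Rintegral_haar_lincomb eta I (fun b => (Num.sqrt (dlen I))^-1 * (-1) ^+ b)).1.
Qed.

(** The square of a Haar function is [1 / dlen] on both halves. For distinct intervals the product
    is a multiple of the Haar function of the finer level, whose integral vanishes. *)
Lemma haar_orthonormal eta I J :
  mu.-integrable setT (EFin \o (fun x => haar eta I x * haar eta J x)) /\
  Rintegral mu setT (fun x => haar eta I x * haar eta J x) = (I == J)%:R.
Proof.
have [->|nIJ] := eqVneq I J.
  rewrite (_ : (fun x => _) = (fun x => \sum_(b <- [:: false; true])
      (fun=> (dlen J)^-1) b * \1_(ditv eta (dyad_half eta J b)) x)); last first.
    apply/funext => x; rewrite haarE big_cons big_seq1 mulrACA -expr2 exprVn.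
    rewrite sqr_sqrtr ?ltW ?dlen_gt0// -mulrDr; congr (_ * _).
    have : ~~ ((x \in ditv eta (dyad_half eta J false)) &&
               (x \in ditv eta (dyad_half eta J true))).
      by apply/negP => /andP[/set_mem/half_disjoint h /set_mem].
    rewrite !indicE; case: (x \in _); case: (x \in _) => //= _;
      by rewrite ?subr0 ?sub0r ?subrr ?mulrNN ?mulr1 ?mulr0 ?addr0 ?add0r.
  have [hi he] := Rintegral_haar_lincomb eta J (fun=> (dlen J)^-1).
  split; first exact: hi.
  rewrite he.
  have l0 : dlen J != 0 by rewrite gt_eqF ?dlen_gt0.
  by rewrite mulr1n; field.
wlog le : I J nIJ / I.1 <= J.1.
  move=> h; have [le|/ltW le] := leP I.1 J.1; first exact: h.
  rewrite (_ : (fun x => _) = (fun x => haar eta J x * haar eta I x)).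
    by apply: h => //; rewrite eq_sym.
  by apply/funext => x; rewrite mulrC.
have [c hc] := haar_mul eta le nIJ.
rewrite (_ : (fun x => _) = (fun x => c * haar eta J x)); last exact/funext.
split; first exact: (integrableZl measurableT c (integrable_haar eta J)).
by rewrite RintegralZl ?Rintegral_haar ?mulr0//; exact: integrable_haar.
Qed.

End Haar.

Section Bessel.
Variable R : realType.
Local Notation mu := (@lebesgue_measure R).
Local Notation mu2 := (@lebesgue_measure R \x @lebesgue_measure R)%E.
Local Notation dlen := (@dlen R).
Local Notation haar := (@haar R).
Local Notation haar2 := (@haar2 R).
Local Notation dleft := (@dleft R).

Lemma test2_integrable (f : R * R -> R) : test2 f -> mu2.-integrable setT (EFin \o f).
Proof.
move=> [mf [M hM]].
have mE : measurable_fun setT (EFin \o f) by exact/measurable_EFinP.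
apply/integrableP; split => //.
pose B : set (R * R) := `[- M, M]%classic `*` `[- M, M]%classic.
have mI : measurable (`[- M, M]%classic : set R) by exact: measurable_itv.
have mB : measurable B by exact: measurableX.
have M0 : 0 <= M by apply: le_trans (hM (0, 0)).1.
(* The sum with one term puts the majorant in the form of [ge0_integral_sum_indic]. *)
apply: (@le_lt_trans _ _ (\int[mu2]_z (\sum_(i <- [:: tt]) M * \1_B z)%:E)%E).
  apply: ge0_le_integral_nonmeasurable => z; first exact: abse_ge0.
  rewrite /= lee_fin big_seq1 indicE.
  have [zM|/(hM z).2 ->] := leP `|z| M; last by rewrite normr0 mulr_ge0.
  rewrite mem_set ?mulr1; first exact: (hM z).1.
  move: zM; rewrite prod_normE ge_max => /andP[z1 z2].
  by split; rewrite /= in_itv /= -ler_norml.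
rewrite (@ge0_integral_sum_indic _ _ _ mu2 _ [:: tt] (fun=> M) (fun=> B))//.
rewrite big_seq1.
have BE : mu2 B = (mu `[(- M)%R, M]%classic * mu `[(- M)%R, M]%classic)%E.
  exact: product_measure1E.
rewrite [X in (_ * X)%E]BE lebesgue_measure_itv /=.
by case: ifP => _; rewrite -?EFinD -?EFinM ?mule0 ?ltry.
Qed.

Lemma test2M (f g : R * R -> R) : test2 f -> test2 g -> test2 (fun z => f z * g z).
Proof.
move=> [mf [M hM]] [mg [N hN]]; split; first exact: measurable_funM.
have M0 : 0 <= M by apply: le_trans (hM (0, 0)).1.
have N0 : 0 <= N by apply: le_trans (hN (0, 0)).1.
(* One constant must bound both the values, at most [M * N], and the support, of radius at most
   [M]. *)
exists (M + M * N) => z; split.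
  rewrite normrM; apply: (@le_trans _ _ (M * N)); last by rewrite lerDr.
  by apply: ler_pM => //; [exact: (hM z).1|exact: (hN z).1].
by move=> zM; rewrite (hM z).2 ?mul0r//; apply: le_lt_trans zM; rewrite lerDl mulr_ge0.
Qed.

Lemma measurable_haar eta I : measurable_fun setT (haar eta I).
Proof.
have /integrableP[/measurable_EFinP//] := @integrable_haar R eta I.
Qed.

Lemma test1_haar eta I : test1 (haar eta I).
Proof.
split; first exact: measurable_haar.
have l0 := dlen_gt0 R I; have s0 : 0 < Num.sqrt (dlen I) by rewrite sqrtr_gt0.
exists ((Num.sqrt (dlen I))^-1 + (`|dleft eta I| + dlen I)) => x.
split.
  apply: (@le_trans _ _ (Num.sqrt (dlen I))^-1); last first.
    by rewrite lerDl addr_ge0// ltW.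
  have i0 : 0 <= (Num.sqrt (dlen I))^-1 by rewrite invr_ge0 ltW.
  rewrite haarE normrM (ger0_norm i0) -[leRHS]mulr1 ler_wpM2l//.
  rewrite !indicE; case: (_ \in _); case: (_ \in _);
    by rewrite ?subrr ?subr0 ?sub0r ?normrN ?normr0 ?normr1.
move=> xM; apply: haar_out => /ditvP/andP[h1 h2].
move: xM; apply/negP; rewrite -leNgt ler_norml.
have i0 : 0 <= (Num.sqrt (dlen I))^-1 by rewrite invr_ge0 ltW.
have := ler_norm (dleft eta I); have := ler_norm (- dleft eta I); rewrite normrN.
by lra.
Qed.

Lemma test2_haar2 w P : test2 (haar2 w P).
Proof.
have [m1 [M hM]] := test1_haar w.1 P.1; have [m2 [N hN]] := test1_haar w.2 P.2.
split.
  by apply: measurable_funM; apply: measurableT_comp.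
have M0 : 0 <= M by apply: le_trans (hM 0).1.
have N0 : 0 <= N by apply: le_trans (hN 0).1.
exists (M * N + (M + N)) => -[x y]; split.
  apply: (@le_trans _ _ (M * N)); last by rewrite lerDl addr_ge0.
  by rewrite /Defs.haar2 /tensor normrM ler_pM ?(hM x).1 ?(hN y).1.
have MN : 0 <= M * N by exact: mulr_ge0.
rewrite prod_normE lt_max /Defs.haar2 /tensor /= => /orP[] h.
  by rewrite (hM x).2 ?mul0r//; lra.
by rewrite (hN y).2 ?mulr0//; lra.
Qed.

Lemma Rintegral_tensor (u v : R -> R) : mu2.-integrable setT (EFin \o tensor u v) ->
  mu.-integrable setT (EFin \o u) -> mu.-integrable setT (EFin \o v) ->
  Rintegral mu2 setT (tensor u v) = Rintegral mu setT u * Rintegral mu setT v.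
Proof.
move=> huv hu hv; rewrite {1}/Rintegral.
have := integral12_prod_meas1 huv; rewrite /fubini_F => <-.
have fv : (\int[mu]_x (v x)%:E = (Rintegral mu setT v)%:E)%E.
  by rewrite /Rintegral fineK//; exact: integrable_fin_num.
transitivity (fine (\int[mu]_x ((Rintegral mu setT v)%:E * (EFin \o u) x))%E).
  congr fine; apply: eq_integral => x _; rewrite /= muleC -fv.
  exact: (integralZl measurableT hv (u x)).
rewrite [X in fine X](integralZl measurableT hu) fineM//; last first.
  exact: (integrable_fin_num measurableT hu).
by rewrite mulrC.
Qed.

Lemma Rintegral_haar2_mul w P Q :
  Rintegral mu2 setT (fun z => haar2 w P z * haar2 w Q z) = (P == Q)%:R.
Proof.
have h : (fun z => haar2 w P z * haar2 w Q z) =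
  tensor (fun x => haar w.1 P.1 x * haar w.1 Q.1 x)
         (fun y => haar w.2 P.2 y * haar w.2 Q.2 y).
  by apply/funext => z; rewrite /Defs.haar2 /tensor mulrACA.
have hi : mu2.-integrable setT (EFin \o (fun z => haar2 w P z * haar2 w Q z)).
  by apply: test2_integrable; apply: test2M; exact: test2_haar2.
have hm eta I J : mu.-integrable setT (EFin \o (fun x => haar eta I x * haar eta J x)).
  exact: (haar_orthonormal R eta I J).1.
rewrite h in hi *; rewrite Rintegral_tensor// !(haar_orthonormal R _ _ _).2 -natrM.
by case: P Q {h hi} => P1 P2 [Q1 Q2] /=; rewrite xpair_eqE mulnb.
Qed.

(** For a finite partial sum [phi] of the Haar expansion, the integral of [(f - phi)^2] is
    nonnegative and equals that of [f^2] minus the sum of the squared coefficients. *)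
Lemma bessel w (f : R * R -> R) : test2 f ->
  (\esum_(P in setT) (haar_coef w f P ^+ 2)%:E <= (Rintegral mu2 setT (fun z => f z * f z))%:E)%E.
Proof.
move=> tf; apply: ge_ereal_sup => _ [X [fX _] <-].
have /finite_seqP[s0 XE] := fX; pose s := undup s0.
have us : uniq s by exact: undup_uniq.
have sX : X = [set` s] by rewrite XE; apply/seteqP; split => Q /=; rewrite mem_undup.
rewrite sX -fsbig_seq// sumEFin lee_fin.
pose c P := haar_coef w f P.
pose phi z := \sum_(P <- s) c P * haar2 w P z.
have int2 g h : test2 g -> test2 h -> mu2.-integrable setT (EFin \o (fun z => g z * h z)).
  by move=> tg th; apply: test2_integrable; exact: test2M.
have [i1 e1] := @Rintegral_lincomb _ _ _ mu2 _ s c (fun P z => f z * haar2 w P z)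
  (fun P _ => int2 _ _ tf (test2_haar2 w P)).
have hphi P : P \in s ->
    mu2.-integrable setT (EFin \o (fun z => haar2 w P z * phi z)) /\
    Rintegral mu2 setT (fun z => haar2 w P z * phi z) = c P.
  move=> sP.
  have [i e] := @Rintegral_lincomb _ _ _ mu2 _ s c (fun Q z => haar2 w P z * haar2 w Q z)
    (fun Q _ => int2 _ _ (test2_haar2 w P) (test2_haar2 w Q)).
  have E : (fun z => haar2 w P z * phi z) =
      (fun z => \sum_(Q <- s) c Q * (haar2 w P z * haar2 w Q z)).
    by apply/funext => z; rewrite mulr_sumr; apply: eq_bigr => Q _; rewrite mulrCA.
  rewrite E; split => //; rewrite e (bigD1_seq P)//= Rintegral_haar2_mul eqxx mulr1.
  rewrite big1 ?addr0// => Q nQP.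
  by rewrite Rintegral_haar2_mul eq_sym (negbTE nQP) mulr0.
have [i2 e2] := @Rintegral_lincomb _ _ _ mu2 _ s c (fun P z => haar2 w P z * phi z)
  (fun P sP => (hphi P sP).1).
(* The square [f^2 - 2 f phi + phi^2] as a linear combination of three functions with weights [b],
   so that linearity of the integral applies at once. *)
pose F (k : nat) z := nth (fun=> 0) [:: (fun z => f z * f z);
  (fun z => \sum_(P <- s) c P * (f z * haar2 w P z));
  (fun z => \sum_(P <- s) c P * (haar2 w P z * phi z))] k z.
pose b (k : nat) : R := nth 0 [:: 1; -2; 1] k.
have [] := @Rintegral_lincomb _ _ _ mu2 _ [:: 0; 1; 2]%N b F.
  move=> k; rewrite !inE => /or3P[]/eqP -> //=.
  exact: int2.
move=> _; rewrite !big_cons big_nil /b /F /= addr0 e1 e2.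
have -> : \sum_(P <- s) c P * Rintegral mu2 setT (fun z => f z * haar2 w P z) =
    \sum_(P <- s) c P ^+ 2.
  by apply: eq_bigr => P _; rewrite expr2.
have -> : \sum_(P <- s) c P * Rintegral mu2 setT (fun z => haar2 w P z * phi z) =
    \sum_(P <- s) c P ^+ 2.
  by rewrite !big_seq; apply: eq_bigr => P sP; rewrite (hphi P sP).2 expr2.
move=> e.
have : 0 <= Rintegral mu2 setT (fun z => \sum_(i <- [:: 0; 1; 2]%N) b i * F i z).
  apply: Rintegral_ge0 => z _; rewrite !big_cons big_nil /b /F /= addr0.
  have -> : \sum_(P <- s) c P * (f z * haar2 w P z) = f z * phi z.
    by rewrite mulr_sumr; apply: eq_bigr => P _; rewrite mulrCA.
  have -> : \sum_(P <- s) c P * (haar2 w P z * phi z) = phi z * phi z.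
    by rewrite mulr_suml; apply: eq_bigr => P _; rewrite mulrA.
  by have := sqr_ge0 (f z - phi z); nra.
by rewrite e; lra.
Qed.

End Bessel.

(** * Summation over complexities and integration over the random grids *)

Theorem corollary3p2 (R : realType) :
  exists eta : R, 0 < eta < 1 /\
  forall (Pr : probability coins R) (T : operator R),
    bernoulli_product Pr -> journe T -> paraproduct_free Pr T ->
  exists delta C : R, 0 < delta /\
  forall f g : R * R -> R,
    test2 f -> test2 g -> finite_haar f -> finite_haar g ->
  exists L : nat * nat -> nat * nat -> coins * coins -> set (set (R * R)),
    (forall i j w, L i j w `<=` grid2 w /\ sparse eta (L i j w)) /\
    (`|T f g|%:E <= C%:E * \int[Pr]_w1 \int[Pr]_w2
       \esum_(ij in [set: (nat * nat) * (nat * nat)])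
         ((decay delta ij.1 ij.2 * tau R ij.1 ij.2)%:E *
          sparse_form (w1, w2) ij.1 ij.2 f g (L ij.1 ij.2 (w1, w2))))%E.
Proof.
exists 4^-1; split; first by rewrite invr_gt0 ltr0n invf_lt1 ?ltr1n.
move=> Pr T _ _ [delta [CT [a [delta0 ha rep]]]].
(* The decay is that of the dyadic representation; 1024 is the constant for a single shift. *)
exists delta, (`|CT| * 1024); split => // f g tf tg _ _.
have finite_energy w (h : R * R -> R) : test2 h ->
    (\esum_(P in setT) (haar_coef w h P ^+ 2)%:E < +oo)%E.
  by move=> th; apply: le_lt_trans (bessel w th) (ltry _).
have dom i j w := shift_domination i j (finite_energy w f tf) (finite_energy w g tg).
(* The families are chosen separately for each complexity and each grid. *)
pose L i j w := sval (cid (dom i j w)).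
have LP i j w : [/\ L i j w `<=` grid2 w, sparse 4^-1 (L i j w) & _] :=
  svalP (cid (dom i j w)).
exists L; split; first by move=> i j w; have [] := LP i j w.
pose S w : \bar R := (\esum_(ij in [set: (nat * nat) * (nat * nat)])
  ((decay delta ij.1 ij.2 * tau R ij.1 ij.2)%:E *
   sparse_form w ij.1 ij.2 f g (L ij.1 ij.2 w)))%E.
have term0 i j w : (0 <= (decay delta i j * tau R i j)%:E *
    sparse_form w i j f g (L i j w))%E.
  apply: mule_ge0; last exact: sparse_form_ge0.
  by rewrite lee_fin !mulr_ge0 ?powR_ge0// exprn_ge0// invr_ge0.
have S0 w : (0 <= S w)%E by apply: esum_ge0 => ij _; exact: term0.
have c0 : (0 < 1024 :> R)%R by rewrite ltr0n.
have cE0 : (0 <= 1024%:E :> \bar R)%E by rewrite lee_fin ltW.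
have pointwise w : (`|ssum [set: (nat * nat) * (nat * nat)] (fun ij =>
    (decay delta ij.1 ij.2)%:E *
    shift_pairing w ij.1 ij.2 (a w ij.1 ij.2) f g)| <= 1024%:E * S w)%E.
  apply: le_trans (abse_ssum_le _ _) _.
  apply: le_trans; last by apply: ge0_esumZl_le => // ij; exact: term0.
  apply: le_esum => -[i j] _ /=.
  have d0 : (0 <= (decay delta i j)%:E)%E by rewrite lee_fin mulr_ge0 ?powR_ge0.
  rewrite abseM gee0_abs// (EFinM (decay delta i j)) -[in leRHS]muleA [leRHS]muleCA.
  have [_ _ /(_ _ (ha w i j)) h] := LP i j w.
  exact: (lee_wpmul2l d0 h).
have -> : `|T f g|%:E = (`|CT|%:E * `|\int[Pr]_w1 \int[Pr]_w2
             ssum [set: (nat * nat) * (nat * nat)] (fun ij =>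
               (decay delta ij.1 ij.2)%:E *
               shift_pairing (w1, w2) ij.1 ij.2 (a (w1, w2) ij.1 ij.2) f g)|)%E.
  by rewrite -abse_EFin rep// abseM.
rewrite EFinM -muleA; apply: lee_wpmul2l; first by rewrite lee_fin.
apply: le_trans (abse_integral_le _ _) _.
(* The constant leaves the two integrals one after the other, and the modulus enters them
   likewise. *)
apply: (@le_trans _ _ (\int[Pr]_w1 (1024%:E * \int[Pr]_w2 S (w1, w2)))%E); last first.
  by apply: ge0_integralZl_le => // w1; apply: integral_ge0.
apply: ge0_le_integral_nonmeasurable => w1; first exact: abse_ge0.
apply: le_trans (abse_integral_le _ _) _.
apply: le_trans; last by apply: ge0_integralZl_le => // w2; exact: S0.
by apply: ge0_le_integral_nonmeasurable => w2; [exact: abse_ge0|exact: pointwise].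
Qed.
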